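(* Let $G$ be a generalized Halin graph such that $\kappa_{LLY}(u,v)>0$ for every edge $\{u,v\}$ of $G$. Then $|V(G)|\le 12$, and $G$ is isomorphic to one of the following graphs: $W_n$ with $4\le n\le 12$; $W_n'$ with $5\le n\le 9$; $W_n''$ with $6\le n\le 10$; or $H_i$ with $1\le i\le 8$.
   Context: All graphs are finite, simple, undirected and connected; $d(\cdot,\cdot)$ is the combinatorial (shortest-path) distance and $d_v$ the degree of $v$. Lin-Lu-Yau curvature: for a vertex $v$ and $\alpha\in[0,1]$ let $m_v^\alpha$ be the probability measure with $m_v^\alpha(v)=\alpha$, $m_v^\alpha(u)=(1-\alpha)/d_v$ for each neighbor $u$ of $v$, and $0$ elsewhere. For probability measures $m_1,m_2$ on $V$, $W(m_1,m_2)=\inf_\pi\sum_{u,w}\pi(u,w)d(u,w)$, the infimum over all $\pi:V\times V\to[0,1]$ with $\sum_w\pi(u,w)=m_1(u)$ for all $u$ and $\sum_u\pi(u,w)=m_2(w)$ for all $w$. For an edge $\{u,v\}$, $\kappa_\alpha(u,v)=1-W(m_u^\alpha,m_v^\alpha)$ and $\kappa_{LLY}(u,v)=\lim_{\alpha\to1}\kappa_\alpha(u,v)/(1-\alpha)$. Generalized Halin graph: take a tree $T$ with maximum degree $D(T)\ge 3$ together with a planar embedding, and add a cycle $C$ through all leaves of $T$, visiting them in the cyclic order in which they appear in the embedding; the resulting graph $H(T,C)$ is a generalized Halin graph (vertices of degree $2$ are allowed). $W_n$ is the wheel on $n$ vertices: a vertex $v_0$ joined to every vertex of a cycle $v_1v_2\cdots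 v_{n-1}$. $W_n'$ is obtained from $W_{n-1}$ by subdividing the edge $v_0v_1$ once. $W_n''$ is obtained from $W_{n-2}$ (with rim cycle $v_1\cdots v_{n-3}$) by subdividing each of the two edges $v_0v_1$ and $v_0v_{\lceil (n-2)/2\rceil}$ once. The graphs $H_1,\dots,H_8$ are: $H_1$: vertices $x,a_1,a_2,a_3,p_1,p_2,p_3$; edges $xa_i, a_ip_i$ ($i=1,2,3$), $p_1p_2,p_2p_3,p_3p_1$. $H_2$: vertices $x,a,b,p,q_1,q_2$; edges $xa,ab,bp,xq_1,xq_2,pq_1,q_1q_2,q_2p$. $H_3$: the triangular prism: vertices $x,q,r,y,p_1,p_2$; edges $xq,qr,rx,yp_1,p_1p_2,p_2y,xy,qp_2,rp_1$. $H_4$: the prism $H_3$ with the triangle edge $xq$ subdivided once: vertices $x,w,q,r,y,p_1,p_2$; edges $xw,wq,qr,rx,yp_1,p_1p_2,p_2y,xy,qp_2,rp_1$. $H_5$: the prism $H_3$ with the non-triangle edge $xy$ subdivided once: vertices $x,z,y,q,r,p_1,p_2$; edges $xq,qr,rx,yp_1,p_1p_2,p_2y,xz,zy,qp_2,rp_1$. $H_6$: vertices $x,a_1,a_2,q_1,q_2,q_3,q_4$; edges $xa_1,a_1q_1,xa_2,a_2q_2,xq_3,xq_4,q_1q_2,q_2q_3,q_3q_4,q_4q_1$ (i.e. $W_5$ with the spokes to two adjacent rim vertices each subdivided once). $H_7$: vertices $x,y,y_1,y_2,x_1,x_2,x_3$; edges $xy,xx_1,xx_2,xx_3,yy_1,yy_2,y_1y_2,y_2x_1,x_1x_2,x_2x_3,x_3y_1$.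 $H_8$: $H_7$ with the edge $xx_2$ subdivided once by a new vertex. *)

(* Defs.v *)
From HB Require Import structures.
From mathcomp Require Import all_boot all_order all_algebra.
From mathcomp Require Import all_classical all_reals all_analysis.
Set Implicit Arguments. Unset Strict Implicit. Unset Printing Implicit Defensive.
Import Order.TTheory GRing.Theory Num.Theory.
Import numFieldNormedType.Exports.
Local Open Scope ring_scope.

Definition simple_graph (V : finType) (e : rel V) : Prop :=
  symmetric e /\ irreflexive e.

Definition connected_graph (V : finType) (e : rel V) : Prop :=
  forall x y : V, connect e x y.

Definition deg (V : finType) (e : rel V) (v : V) : nat := #|[set w | e v w]|.

Fixpoint ball (V : finType) (e : rel V) (n : nat) (x : V) : {set V} :=
  match n with
  | 0 => [set x]
  | n'.+1 => ball e n' x :|: [set w | [exists u in ball e n' x, e u w]]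
  end.

(* combinatorial distance: least n with y in ball e n x
   (for a connected graph this is < #|V|, so it is found in iota 0 #|V|) *)
Definition dist (V : finType) (e : rel V) (x y : V) : nat :=
  find (fun n => y \in ball e n x) (iota 0 #|V|).

Section Curv.
Local Open Scope classical_set_scope.
Variable R : realType.

Definition lazy_measure (V : finType) (e : rel V) (a : R) (v : V) : V -> R :=
  fun u => if u == v then a
           else if e v u then (1 - a) / (deg e v)%:R else 0.

Definition is_coupling (V : finType) (m1 m2 : V -> R) (pi : V -> V -> R) : Prop :=
  (forall u w, 0 <= pi u w <= 1) /\
  (forall u, \sum_(w : V) pi u w = m1 u) /\
  (forall w, \sum_(u : V) pi u w = m2 w).

Definition wasserstein (V : finType) (e : rel V) (m1 m2 : V -> R) : R :=
  inf [set c : R | exists pi : V -> V -> R, is_coupling m1 m2 pi /\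
         c = \sum_(u : V) \sum_(w : V) pi u w * (dist e u w)%:R].

Definition kappa_alpha (V : finType) (e : rel V) (a : R) (u v : V) : R :=
  1 - wasserstein e (lazy_measure e a u) (lazy_measure e a v).

Definition LLY_curvature_is (V : finType) (e : rel V) (u v : V) (k : R) : Prop :=
  kappa_alpha e a u v / (1 - a) @[a --> at_left (1 : R)] --> k.
End Curv.

(* A tree t on V (spanning: all of V), symmetric irreflexive, connected, |E| = |V|-1
   (ordered pairs counted twice). *)
Definition is_tree (V : finType) (t : rel V) : Prop :=
  simple_graph t /\ connected_graph t /\
  #|[set p : V * V | t p.1 p.2]| = (2 * (#|V| - 1))%N.

Definition leaf (V : finType) (t : rel V) (x : V) : bool := deg t x == 1%N.

(* A planar embedding of a tree is given by a rotation system: for each vertex v,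
   rho v cyclically permutes the tree-neighbours of v (one single cycle). *)
Definition rotation_system (V : finType) (t : rel V) (rho : V -> V -> V) : Prop :=
  (forall v u, t v u -> t v (rho v u)) /\
  (forall v u w, t v u -> t v w -> fconnect (rho v) u w).

(* face-tracing map on darts (v,w): next dart is (w, rho w v) *)
Definition next_dart (V : finType) (rho : V -> V -> V) (d : V * V) : V * V :=
  (d.2, rho d.2 d.1).

(* y is the leaf following the leaf x in the cyclic order in which leaves are met
   when walking around the (unique) face of the embedded tree *)
Definition leaf_succ (V : finType) (t : rel V) (rho : V -> V -> V) (x y : V) : Prop :=
  leaf t x /\ leaf t y /\
  exists (p : V) (k : nat), t p x /\ (0 < k)%N /\
    (iter k (next_dart rho) (p, x)).2 = y /\
    (forall j, (0 < j < k)%N -> ~~ leaf t (iter j (next_dart rho) (p, x)).2).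

Definition gen_halin (V : finType) (e : rel V) : Prop :=
  exists (t : rel V) (rho : V -> V -> V),
    is_tree t /\ (exists v, (3 <= deg t v)%N) /\ rotation_system t rho /\
    forall x y, e x y <-> (t x y \/ leaf_succ t rho x y \/ leaf_succ t rho y x).

Definition sym_rel (r : nat -> nat -> bool) : nat -> nat -> bool :=
  fun i j => r i j || r j i.

Definition ord_rel (n : nat) (r : nat -> nat -> bool) : rel 'I_n :=
  fun x y => sym_rel r (x : nat) (y : nat).

Definition list_rel (l : seq (nat * nat)) : nat -> nat -> bool :=
  fun i j => (i, j) \in l.

Arguments ord_rel : clear implicits.

(* wheel on n vertices: hub 0, rim cycle 1,2,...,n-1 *)
Definition wheel_r (n : nat) : nat -> nat -> bool :=
  fun i j => [|| (i == 0%N) && (1 <= j < n)%N,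
                 [&& (1 <= i)%N, j == i.+1 & (j < n)%N] |
                 (i == 1%N) && (j == n.-1)].

Definition W (n : nat) : rel 'I_n := ord_rel n (wheel_r n).

(* W'_n: W_{n-1} with spoke v0v1 subdivided by the new vertex n-1 *)
Definition W1_r (n : nat) : nat -> nat -> bool :=
  fun i j => (sym_rel (wheel_r n.-1) i j && ~~ sym_rel (list_rel [:: (0, 1)]) i j)%N
             || list_rel [:: (0, n.-1); (n.-1, 1)]%N i j.

Definition W1 (n : nat) : rel 'I_n := ord_rel n (W1_r n).

(* W''_n: W_{n-2} (rim 1..n-3) with spokes v0v1 and v0v_c, c = ceil((n-2)/2),
   subdivided by new vertices n-2 and n-1 respectively *)
Definition W2_r (n : nat) : nat -> nat -> bool :=
  fun i j => let c := uphalf (n - 2) in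
             (sym_rel (wheel_r (n - 2)) i j &&
               ~~ sym_rel (list_rel [:: (0, 1); (0, c)]) i j)%N
             || list_rel [:: (0, n - 2); (n - 2, 1); (0, n.-1); (n.-1, c)]%N i j.

Definition W2 (n : nat) : rel 'I_n := ord_rel n (W2_r n).

Arguments W : clear implicits.
Arguments W1 : clear implicits.
Arguments W2 : clear implicits.

(* H_1 : x=0 a1=1 a2=2 a3=3 p1=4 p2=5 p3=6 *)
Definition H1 : rel 'I_7 := ord_rel 7 (list_rel
  [:: (0,1); (0,2); (0,3); (1,4); (2,5); (3,6); (4,5); (5,6); (6,4)]%N).
(* H_2 : x=0 a=1 b=2 p=3 q1=4 q2=5 *)
Definition H2 : rel 'I_6 := ord_rel 6 (list_rel
  [:: (0,1); (1,2); (2,3); (0,4); (0,5); (3,4); (4,5); (5,3)]%N).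
(* H_3 : x=0 q=1 r=2 y=3 p1=4 p2=5 *)
Definition H3 : rel 'I_6 := ord_rel 6 (list_rel
  [:: (0,1); (1,2); (2,0); (3,4); (4,5); (5,3); (0,3); (1,5); (2,4)]%N).
(* H_4 : x=0 w=1 q=2 r=3 y=4 p1=5 p2=6 *)
Definition H4 : rel 'I_7 := ord_rel 7 (list_rel
  [:: (0,1); (1,2); (2,3); (3,0); (4,5); (5,6); (6,4); (0,4); (2,6); (3,5)]%N).
(* H_5 : x=0 z=1 y=2 q=3 r=4 p1=5 p2=6 *)
Definition H5 : rel 'I_7 := ord_rel 7 (list_rel
  [:: (0,3); (3,4); (4,0); (2,5); (5,6); (6,2); (0,1); (1,2); (3,6); (4,5)]%N).
(* H_6 : x=0 a1=1 a2=2 q1=3 q2=4 q3=5 q4=6 *)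
Definition H6 : rel 'I_7 := ord_rel 7 (list_rel
  [:: (0,1); (1,3); (0,2); (2,4); (0,5); (0,6); (3,4); (4,5); (5,6); (6,3)]%N).
(* H_7 : x=0 y=1 y1=2 y2=3 x1=4 x2=5 x3=6 *)
Definition H7 : rel 'I_7 := ord_rel 7 (list_rel
  [:: (0,1); (0,4); (0,5); (0,6); (1,2); (1,3); (2,3); (3,4); (4,5); (5,6); (6,2)]%N).
(* H_8 : H_7 with edge x x2 = (0,5) subdivided by new vertex 7 *)
Definition H8 : rel 'I_8 := ord_rel 8 (list_rel
  [:: (0,1); (0,4); (0,7); (7,5); (0,6); (1,2); (1,3); (2,3); (3,4); (4,5); (5,6); (6,2)]%N).

Definition isomorphic (V U : finType) (e : rel V) (f : rel U) : Prop :=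
  exists g : V -> U, bijective g /\ forall x y, e x y = f (g x) (g y).

(* Main.v *)
(* Integrating a 1-Lipschitz function f with f(v) = f(u) + 1 against the two lazy measures
   bounds the curvature of the edge uv by Lf(u) - Lf(v), L being the normalised Laplacian.
   Positive curvature thus yields an inequality for every integer-valued such f.

   Removing an edge pq of the tree leaves two sides joined in the graph by pq and by two
   edges of the outer cycle only: the walk along the face from a leaf to the next one never
   backtracks at an internal vertex, hence is a geodesic of the tree. A test function that
   is almost constant on both sides then bounds the degrees of two adjacent internal
   vertices and makes most of their neighbours leaves. It follows that the tree consists of
   a hub carrying branches of five possible shapes, so that the graph is determined by the
   cyclic word of these shapes. Truncated distance functions bound the degree of the hub by
   5, 7 or 11, according to whether there is a forked branch, a subdivided spoke, or
   neither. Each of the remaining words is either excluded by the distance to at most two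
   vertices or gives one of the listed graphs; this is decided by computation. *)

Require Import Defs.
From HB Require Import structures.
From mathcomp Require Import all_boot all_order all_algebra.
From mathcomp Require Import all_classical all_reals all_analysis.
From mathcomp Require Import ring lra zify.
Import Order.TTheory GRing.Theory Num.Theory.
Import numFieldNormedType.Exports.
Set Implicit Arguments. Unset Strict Implicit. Unset Printing Implicit Defensive.

(** * The curvature condition on integer Lipschitz functions *)

Local Open Scope ring_scope.

Definition lip1 (V : finType) (e : rel V) (f : V -> int) : Prop :=
  forall x y, e x y -> f y <= f x + 1.

(** Says that Lf(u) - Lf(v) > 0 for the normalised Laplacian L, multiplied by both degrees so that
    only integers occur. *)
Definition curv_pos (V : finType) (e : rel V) : Prop :=
  forall u v (f : V -> int), e u v -> lip1 e f -> f v = f u + 1 ->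
  (deg e u)%:Z * (\sum_(w | e v w) (f w - f v)) <
  (deg e v)%:Z * (\sum_(w | e u w) (f w - f u)).

Lemma lip1_path (V : finType) (e : rel V) f x p :
  lip1 e f -> path e x p -> f (last x p) <= f x + (size p)%:Z.
Proof.
move=> Lf; elim: p x => [|y p IHp] x /=; first by lia.
by case/andP=> /Lf exy /IHp; lia.
Qed.

Lemma lip1_ball (V : finType) (e : rel V) f n x y :
  lip1 e f -> y \in Defs.ball e n x -> f y <= f x + n%:Z.
Proof.
move=> Lf; elim: n y => [|n IHn] y /=; first by rewrite inE => /eqP->; lia.
rewrite !inE => /orP[/IHn|/existsP[u /andP[/IHn fu /Lf]]]; lia.
Qed.

Lemma lip1_dist (V : finType) (e : rel V) f x y :
  connected_graph e -> lip1 e f -> f y - f x <= (dist e x y)%:Z.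
Proof.
move=> Ce Lf; rewrite /dist.
have [found|] := boolP (has (fun n => y \in Defs.ball e n x) (iota 0 #|V|)).
  have := nth_find 0%N found; set k := find _ _.
  have ltk : (k < #|V|)%N by move: found; rewrite has_find size_iota.
  by rewrite nth_iota // => /(lip1_ball Lf); lia.
(* Now [dist] has its default value [#|V|], and a path without repeated vertices is shorter than
   that. *)
move/hasNfind->; rewrite size_iota.
have /connectP[p ep ->] := Ce x y.
case/shortenP: ep => p' ep' up' _.
have := lip1_path Lf ep'.
have : (size p' < #|V|)%N by rewrite -[(size p').+1]/(size (x :: p')) -(card_uniqP up') max_card.
move: #|V| (size p') (f x) (f _) => N n a b nN ba; lia.
Qed.

Section Curvature.
Variables (R : realType) (V : finType) (e : rel V).
Hypotheses (Se : simple_graph e) (Ce : connected_graph e).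
Implicit Types (a : R) (u v : V) (f : V -> int).

Let laplacian f v : R := (\sum_(w | e v w) (f w - f v))%:~R / (deg e v)%:R.

Lemma lazy_measure_sum a v (f : V -> R) :
  \sum_x f x * lazy_measure e a v x =
  f v * a + (1 - a) / (deg e v)%:R * \sum_(w | e v w) f w.
Proof.
have [_ irr_e] := Se.
rewrite (bigD1 v) //= /lazy_measure eqxx; congr (_ + _).
rewrite mulr_sumr (bigID (e v)) /= [X in _ + X]big1 ?addr0; last first.
  by move=> x /andP[/negPf-> /negPf->]; rewrite mulr0.
rewrite (eq_bigl (e v)) => [|x]; last first.
  by case: eqP => [->|] //=; rewrite irr_e.
apply: eq_bigr => x evx; case: eqP evx => [->|_ ->]; last by rewrite mulrC.
by rewrite irr_e.
Qed.

Lemma lazy_measure_sumE a v f : (0 < deg e v)%N ->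
  \sum_x (f x)%:~R * lazy_measure e a v x =
  (f v)%:~R + (1 - a) * laplacian f v.
Proof.
move=> dv; rewrite lazy_measure_sum /laplacian sumrB.
rewrite [\sum_(w | e v w) f v]sumr_const rmorphB /= rmorph_sum /=.
have -> : #|e v| = deg e v by rewrite /deg; apply: eq_card => x; rewrite inE.
rewrite rmorphMn /= -mulr_natl.
have : (deg e v)%:R != 0 :> R by rewrite pnatr_eq0 -lt0n.
set d : R := (deg e v)%:R; set S := \sum_(w | _) _ => d0.
by field.
Qed.

Lemma lazy_measure_total a v : (0 < deg e v)%N ->
  \sum_x lazy_measure e a v x = 1.
Proof.
move=> dv; have := @lazy_measure_sumE a v (fun=> 1) dv.
have -> : laplacian (fun=> 1) v = 0.
  by rewrite /laplacian big1 ?mul0r // => w _; rewrite subrr.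
rewrite mulr0 addr0 => E.
by rewrite -[RHS]E; apply: eq_bigr => x _; rewrite mul1r.
Qed.

Lemma lazy_measure_ge0 a v x : 0 <= a <= 1 -> 0 <= lazy_measure e a v x.
Proof.
case/andP=> a0 a1; rewrite /lazy_measure; case: ifP => // _; case: ifP => // _.
by rewrite divr_ge0 ?subr_ge0.
Qed.

Lemma lazy_measure_le1 a v x : (0 < deg e v)%N -> 0 <= a <= 1 ->
  lazy_measure e a v x <= 1.
Proof.
move=> dv a01; rewrite -(lazy_measure_total a dv) (bigD1 x) //= lerDl.
by apply: sumr_ge0 => y _; exact: lazy_measure_ge0.
Qed.

(* The easy half of Kantorovich duality. *)
Lemma wasserstein_ge a u v f : (0 < deg e u)%N -> (0 < deg e v)%N ->
  0 <= a <= 1 -> lip1 e f ->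
  ((f v)%:~R + (1 - a) * laplacian f v) - ((f u)%:~R + (1 - a) * laplacian f u)
  <= wasserstein e (lazy_measure e a u) (lazy_measure e a v).
Proof.
move=> du dv a01 Lf; rewrite -!lazy_measure_sumE //.
apply: lb_le_inf.
  (* The product coupling shows that the set of costs is nonempty, so that its infimum is a genuine
     one. *)
  exists (\sum_x \sum_y (lazy_measure e a u x * lazy_measure e a v y) *
            (dist e x y)%:R); exists (fun x y => lazy_measure e a u x * lazy_measure e a v y).
  split=> //; split=> [x y|]; last split=> x.
  - by rewrite mulr_ge0 ?lazy_measure_ge0 // mulr_ile1 ?lazy_measure_ge0 ?lazy_measure_le1.
  - by rewrite -mulr_sumr lazy_measure_total ?mulr1.
  - by rewrite -mulr_suml lazy_measure_total ?mul1r.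
move=> _ [pi [[pi01 [pi1 pi2]] ->]].
have -> : \sum_x (f x)%:~R * lazy_measure e a v x =
          \sum_x \sum_y pi x y * (f y)%:~R.
  rewrite exchange_big /=; apply: eq_bigr => y _.
  by rewrite -mulr_suml pi2 mulrC.
have -> : \sum_x (f x)%:~R * lazy_measure e a u x =
          \sum_x \sum_y pi x y * (f x)%:~R.
  by apply: eq_bigr => x _; rewrite -mulr_suml pi1 mulrC.
rewrite -sumrB; apply: ler_sum => x _; rewrite -sumrB; apply: ler_sum => y _.
rewrite -mulrBr ler_wpM2l //; first by case/andP: (pi01 x y).
by rewrite -rmorphB /= -[(dist e x y)%:R]/((dist e x y)%:Z%:~R) ler_int lip1_dist.
Qed.

(** For every [a] in (0, 1) duality bounds [kappa_alpha] by [1 - a] times the right-hand side: the 1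
    in [kappa_alpha] cancels [f v - f u]. The bound passes to the limit. *)
Lemma LLY_curvature_le u v f (k : R) : e u v -> lip1 e f -> f v = f u + 1 ->
  LLY_curvature_is e u v k -> k <= laplacian f u - laplacian f v.
Proof.
have [sym_e _] := Se.
move=> euv Lf fuv Hk.
have du : (0 < deg e u)%N by apply/card_gt0P; exists v; rewrite inE.
have dv : (0 < deg e v)%N by apply/card_gt0P; exists u; rewrite inE sym_e.
have <- := cvg_lim (@Rhausdorff R) Hk.
apply: limr_le; first by apply/cvg_ex; exists k.
near=> a.
have a1 : a < 1 by near: a; exact: nbhs_left_lt.
have a0 : 0 < a by near: a; exact: nbhs_left_gt.
have a01 : 0 <= a <= 1 by rewrite !ltW.
rewrite ler_pdivrMr ?subr_gt0 // /kappa_alpha.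
have := wasserstein_ge du dv a01 Lf; rewrite fuv rmorphD /= mulr1z.
set W := wasserstein _ _ _; lra.
Unshelve. all: by end_near. Qed.

Lemma positive_LLY_curv_pos :
  (forall u v, e u v -> exists k : R, 0 < k /\ LLY_curvature_is e u v k) ->
  curv_pos e.
Proof.
have [sym_e _] := Se.
move=> pos u v f euv Lf fuv; have [k [k0 Hk]] := pos u v euv.
have du : (0 < deg e u)%N by apply/card_gt0P; exists v; rewrite inE.
have dv : (0 < deg e v)%N by apply/card_gt0P; exists u; rewrite inE sym_e.
have := lt_le_trans k0 (LLY_curvature_le euv Lf fuv Hk).
rewrite /laplacian subr_gt0 ltr_pdivrMr ?ltr0n // mulrAC ltr_pdivlMr ?ltr0n //.
rewrite -[(deg e u)%:R]/((deg e u)%:Z%:~R) -[(deg e v)%:R]/((deg e v)%:Z%:~R).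
by rewrite -!rmorphM /= ltr_int mulrC [X in _ < X]mulrC.
Qed.

End Curvature.

Local Close Scope ring_scope.

(** * Sides of a tree edge *)

Section SpanningTreeCount.
Variables (V : finType) (r : rel V) (x0 : V).
Hypotheses (symr : symmetric r) (conr : connected_graph r).

(** [d] is the distance to [x0]; the first step of a shortest path shows that some neighbour is
    closer, and [par] picks such a neighbour. *)
Lemma exists_parent_function : exists (d : V -> nat) (par : V -> V),
  forall x, x != x0 -> r x (par x) /\ (d (par x) < d x)%N.
Proof.
pose P x n := [exists p : n.-tuple V, path r x p && (last x p == x0)].
have exP x : exists n, P x n.
  have /connectP[p rp ep] := conr x x0.
  by exists (size p); apply/existsP; exists (in_tuple p); rewrite rp -ep eqxx.
pose d x := ex_minn (exP x).
have dP x : x != x0 -> exists y, r x y && (d y < d x)%N.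
  move=> xx0; rewrite /d; case: (ex_minnP (exP x)) => n /existsP[[[|y p] sp]] /=.
    by rewrite (negPf xx0).
  move=> /andP[/andP[rxy rp] lp] _; exists y; rewrite rxy /=.
  case: ex_minnP => m _; move/eqP: sp => /= <-; rewrite ltnS; apply.
  by apply/existsP; exists (in_tuple p); rewrite /= rp lp.
exists d, (fun x => odflt x [pick y | r x y && (d y < d x)%N]) => x xx0.
case: pickP => [y /andP[]//|no]; have [y] := dP x xx0.
by rewrite no.
Qed.

(** Each vertex other than [x0] contributes the edge to its parent, in both orientations. Nothing is
    counted twice, since [d] decreases along an edge in one direction only. *)
Lemma connected_card_edges : (2 * (#|V| - 1) <= #|[set p : V * V | r p.1 p.2]|)%N.
Proof.
have [d [par parP]] := exists_parent_function.
pose A := [set~ x0].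
have cA : #|A| = (#|V| - 1)%N by rewrite cardsC1 subn1.
pose up := [set (x, par x) | x in A]; pose dn := [set (par x, x) | x in A].
have cup : #|up| = #|A| by rewrite card_in_imset // => x y _ _ [].
have cdn : #|dn| = #|A| by rewrite card_in_imset // => x y _ _ [].
have dis : up :&: dn = finset.set0.
  apply/setP => p; rewrite !inE; apply/negP => /andP[/imsetP[x xA ->] /imsetP[y yA [xy yx]]].
  move: xA yA; rewrite !inE => /parP[_ dx] /parP[_ dy].
  by move: dx dy; rewrite yx -xy; lia.
rewrite mul2n -addnn -{1}cA -cA -{1}cup -cdn.
have := cardsUI up dn; rewrite dis cards0 addn0 => <-.
apply: subset_leq_card; apply/fintype.subsetP => p; rewrite !inE.
case/orP=> /imsetP[x]; rewrite !inE => /parP[rx _] -> //=; last by rewrite symr.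
Qed.
End SpanningTreeCount.

Section Tree.
Variables (V : finType) (t : rel V).
Hypothesis tree_t : is_tree t.
Implicit Types u v w x y : V.

Let symt : symmetric t. Proof. by case: tree_t => -[]. Qed.
Let irrt : irreflexive t. Proof. by case: tree_t => -[]. Qed.
Let cont : connected_graph t. Proof. by case: tree_t => _ []. Qed.

Definition cut u v := [rel x y | [&& t x y, (x, y) != (u, v) & (x, y) != (v, u)]].
Definition side u v := [set x | connect (cut u v) v x].

Lemma cut_sym u v : symmetric (cut u v).
Proof.
move=> x y /=; rewrite symt !xpair_eqE (andbC (y == u)) (andbC (y == v)).
by congr andb; rewrite andbC.
Qed.

Lemma cut_symC u v : cut u v =2 cut v u.
Proof. by move=> x y /=; congr andb; rewrite andbC. Qed.

Lemma side_refl u v : v \in side u v.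
Proof. by rewrite inE connect0. Qed.

(** If [u] were still reachable, the tree without the edge [uv] would be connected with fewer edges
    than [connected_card_edges] permits. Here the edge count in [is_tree] rules out cycles. *)
Lemma side_root u v : t u v -> u \notin side u v.
Proof.
move=> tuv; rewrite inE; apply/negP => cvu.
have con : connected_graph (cut u v).
  move=> x y; apply: connect_sub (cont x y) => a b tab.
  have [/eqP[-> ->]|n1] := boolP ((a, b) == (u, v)).
    by rewrite (sym_connect_sym (@cut_sym u v)).
  have [/eqP[-> ->] //|n2] := boolP ((a, b) == (v, u)).
  by apply: connect1; rewrite /= tab n1.
have := connected_card_edges u (@cut_sym u v) con.
have [_ [_ <-]] := tree_t.
rewrite leqNgt => /negP; apply; apply: proper_card; apply/properP; split.
  by apply/fintype.subsetP => p; rewrite !inE => /and3P[].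
by exists (u, v); rewrite !inE /= ?tuv ?eqxx.
Qed.

Lemma closed_connected (r : rel V) (A : {pred V}) x0 : connected_graph r ->
  x0 \in A -> (forall x y, x \in A -> r x y -> y \in A) -> forall x, x \in A.
Proof.
move=> con A0 cl x; have /connectP[p rp ->] := con x0 x.
elim: p x0 A0 rp => [|y p IHp] //= z Az /andP[rzy rp].
by apply: IHp => //; apply: cl rzy.
Qed.

Lemma side_step u v x y : t u v -> x \in side u v -> t x y ->
  (x != v) || (y != u) -> y \in side u v.
Proof.
move=> tuv xS txy nxy; move: (xS); rewrite !inE => /connect_trans; apply.
apply: connect1; rewrite /= txy !xpair_eqE.
have -> : x == u = false by apply: contraTF xS => /eqP->; exact: side_root.
by rewrite !negb_and /= nxy.
Qed.

Lemma side_ind u v (P : V -> Prop) : t u v -> P v ->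
  (forall x y, x \in side u v -> y \in side u v -> t x y -> P x -> P y) ->
  forall x, x \in side u v -> P x.
Proof.
move=> tuv Pv step x; rewrite inE => /connectP[p cp ->].
elim/last_ind: p cp => [|p y IHp] //; rewrite rcons_path last_rcons.
move=> /andP[cp cy]; apply: step (IHp cp).
- by rewrite inE; apply/connectP; exists p.
- rewrite inE; apply: connect_trans (connect1 cy).
  by apply/connectP; exists p.
- by case/and3P: cy.
Qed.

Lemma side_cross u v x y : t u v -> x \in side u v -> y \notin side u v ->
  t x y -> x = v /\ y = u.
Proof.
move=> tuv xS yS txy; have n := side_step tuv xS txy.
by split; apply/eqP/(contraNT _ yS) => ne; apply: n; rewrite ne ?orbT.
Qed.

Lemma side_cover u v x : t u v -> x \in side u v :|: side v u.
Proof.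
move=> tuv; have tvu : t v u by rewrite symt.
apply: (closed_connected cont (x0 := v)) => [|{}x y]; rewrite !finset.in_setU.
  by rewrite side_refl.
case/orP=> xS txy.
  have [/eqP->|yu] := boolP (y == u); first by rewrite side_refl orbT.
  by rewrite (side_step tuv xS txy) ?yu ?orbT.
have [/eqP->|yv] := boolP (y == v); first by rewrite side_refl.
by rewrite (side_step tvu xS txy) ?yv ?orbT.
Qed.

Lemma side_disjoint u v x : t u v -> x \in side u v -> x \notin side v u.
Proof.
move=> tuv; rewrite inE => cvx; apply: contra (side_root tuv); rewrite !inE => cux.
rewrite (connect_trans cvx) // (sym_connect_sym (@cut_sym u v)).
by rewrite (eq_connect (cut_symC u v)).
Qed.

(** Going on from [v] without turning back to [u] leads into a smaller component, so a walk that
    never backtracks never returns. *)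
Lemma side_sub u v w x : t u v -> t v w -> w != u -> x \in side v w -> x \in side u v.
Proof.
move=> tuv tvw wu; move: x; apply: (side_ind (P := fun x => x \in side u v) tvw).
  by apply: side_step (side_refl u v) tvw _; rewrite // wu orbT.
move=> x y xS yS txy xS'; apply: (side_step tuv xS' txy).
by have -> : x != v by apply: contraTneq xS => ->; exact: side_root.
Qed.

(** Seen from [q'], the vertex [x] lies beyond [h], that is in [side q' h], the complement of
    [side h q']. *)
Lemma side_disjoint_nbr h q q' x : t h q -> t h q' -> q != q' ->
  x \in side h q -> x \notin side h q'.
Proof.
move=> thq thq' qq' xS; have tq'h : t q' h by rewrite symt.
by apply: side_disjoint => //; apply: side_sub xS.
Qed.

Lemma side_adj u v w : t u v -> t v w -> w != u -> w \in side u v.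
Proof. by move=> tuv tvw wu; apply: side_sub (side_refl v w). Qed.

End Tree.

(** * Rotations as cyclic orders of the neighbours *)

Section Rotation.
Variables (V : finType) (t : rel V) (rho : V -> V -> V).
Hypothesis rot : rotation_system t rho.
Implicit Types u v w x y : V.

Let nbrs v := [set w | t v w].

Lemma rho_adj v u : t v u -> t v (rho v u). Proof. by case: rot => rho_t _; apply: rho_t. Qed.

Lemma iter_rho_adj v u k : t v u -> t v (iter k (rho v) u).
Proof. by move=> tvu; elim: k => //= k; apply: rho_adj. Qed.

(** Every neighbour lies on the single cycle of [rho v], so [rho v] maps the neighbourhood onto
    itself; finiteness gives injectivity. *)
Lemma rho_inj v u w : t v u -> t v w -> rho v u = rho v w -> u = w.
Proof.
have [_ con] := rot.
have surj : rho v @: nbrs v = nbrs v.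
  apply/eqP; rewrite finset.eqEsubset; apply/andP; split.
    by apply/fintype.subsetP => _ /imsetP[x + ->]; rewrite !inE => /rho_adj.
  apply/fintype.subsetP => x; rewrite inE => tvx.
  have := con v _ _ (rho_adj tvx) tvx => /iter_findex.
  rewrite -iterSr /= => <-; apply: imset_f.
  by rewrite inE iter_rho_adj.
have /imset_injP inj : #|rho v @: nbrs v| == #|nbrs v| by rewrite surj.
by move=> tvu tvw; apply: inj; rewrite inE.
Qed.

Lemma fconnect_rho v u : t v u -> fconnect (rho v) u =i nbrs v.
Proof.
have [_ con] := rot; move=> tvu x; rewrite [RHS]inE; apply/idP/idP => [|tvx].
  by move/iter_findex <-; rewrite iter_rho_adj.
exact: con.
Qed.

Lemma order_rho v u : t v u -> order (rho v) u = deg t v.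
Proof. by move/fconnect_rho/eq_card. Qed.

Lemma uniq_traject_rho v u : t v u -> uniq (traject (rho v) u (deg t v)).
Proof. by move/order_rho <-; apply: orbit_uniq. Qed.

Lemma mem_traject_rho v u x : t v u -> t v x -> x \in traject (rho v) u (deg t v).
Proof.
move=> tvu tvx; have [_ con] := rot.
by rewrite -(order_rho tvu) -/(orbit (rho v) u) -fconnect_orbit; apply: con.
Qed.

Lemma iter_deg_rho v u : t v u -> iter (deg t v) (rho v) u = u.
Proof.
move=> tvu; rewrite -(order_rho tvu).
apply: (@iter_order_in _ _ (nbrs v)); rewrite ?inE //.
  by move=> x; rewrite !inE; apply: rho_adj.
by move=> x y; rewrite !inE; apply: rho_inj.
Qed.

Lemma rho_neq v u : t v u -> (1 < deg t v)%N -> rho v u != u.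
Proof.
move=> tvu; have := uniq_traject_rho tvu; case: (deg t v) => [|[|k]] //=.
by rewrite inE negb_or eq_sym => /andP[/andP[]].
Qed.
End Rotation.

(** * Face walks *)

Section FaceWalk.
Variables (V : finType) (t : rel V) (rho : V -> V -> V).
Hypotheses (tree_t : is_tree t) (rot : rotation_system t rho).
Hypothesis branching : exists v, (3 <= deg t v)%N.
Implicit Types (u v w x y : V) (d : V * V).

Let symt : symmetric t. Proof. by case: tree_t => -[]. Qed.
Let irrt : irreflexive t. Proof. by case: tree_t => -[]. Qed.

Lemma deg_gt0 v u : t v u -> (0 < deg t v)%N.
Proof. by move=> tvu; apply/card_gt0P; exists u; rewrite inE. Qed.

Lemma leaf_nbr x u w : leaf t x -> t x u -> t x w -> u = w.
Proof.
rewrite /leaf /deg => /cards1P[a eqa] txu txw.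
have : u \in [set a] by rewrite -eqa inE.
have : w \in [set a] by rewrite -eqa inE.
by rewrite !inE => /eqP-> /eqP->.
Qed.

Lemma leafN_deg v u : t v u -> ~~ leaf t v -> (1 < deg t v)%N.
Proof. by move=> /deg_gt0; rewrite /leaf; lia. Qed.

Lemma rho_leaf x p : leaf t x -> t x p -> rho x p = p.
Proof. by move=> lx txp; apply: leaf_nbr (rho_adj rot txp) txp. Qed.

Lemma rho_leafN v u : t v u -> ~~ leaf t v -> rho v u != u.
Proof. by move=> tvu lv; apply: (rho_neq rot tvu); apply: leafN_deg tvu lv. Qed.

(** Two adjacent leaves would be closed under adjacency, hence the whole tree, leaving no room for a
    vertex of degree 3. *)
Lemma leaf_parentN x p : leaf t x -> t x p -> ~~ leaf t p.
Proof.
move=> lx txp; apply/negP => lp; have [v dv] := branching.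
have tpx : t p x by rewrite symt.
have : v \in [set x; p].
  apply: (closed_connected (r := t) (x0 := x)); first by case: tree_t => _ [].
    by rewrite !inE eqxx.
  move=> a b; rewrite !inE => /orP[] /eqP-> tab.
    by rewrite (leaf_nbr lx tab txp) eqxx orbT.
  by rewrite (leaf_nbr lp tab tpx) eqxx.
by rewrite !inE => /orP[] /eqP ev; move: lx lp dv; rewrite ev /leaf; lia.
Qed.

(** The first leaf met by the face walk started with [d]. An inductive predicate allows induction
    along the walk instead of on a number of iterations. *)
Inductive lands d : V -> Prop :=
  | lands_here : leaf t d.2 -> lands d d.2
  | lands_next y : ~~ leaf t d.2 -> lands (d.2, rho d.2 d.1) y -> lands d y.

Lemma lands_fun d y z : lands d y -> lands d z -> y = z.
Proof.
move=> L; elim: L z => {d y} [d ld|d y ld _ IH] z L.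
  by case: L ld => // y /negPf->.
by case: L ld IH => [->//|{}z _ L _]; apply.
Qed.

Lemma lands_leaf d y : lands d y -> leaf t y.
Proof. by elim. Qed.

Lemma lands_iter d y : lands d y <->
  exists k, [/\ (iter k (next_dart rho) d).2 = y, leaf t y &
    forall j, (j < k)%N -> ~~ leaf t (iter j (next_dart rho) d).2].
Proof.
split=> [|[k]].
  elim=> {d y} [d ld|d y ld _ [k [ek ly Lk]]]; first by exists 0%N.
  exists k.+1; rewrite iterSr; split=> // -[|j] //; rewrite iterSr; apply: Lk.
elim: k d => [|k IHk] d [ek ly Lk]; first by rewrite -ek; apply: lands_here; rewrite ek.
apply: lands_next; first exact: (Lk 0%N).
apply: (IHk (next_dart rho d)); rewrite -iterSr; split=> // j ltj.
by rewrite -iterSr; apply: Lk.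
Qed.

Definition succ_leaf x y : Prop := leaf t x /\ exists2 p, t x p & lands (x, p) y.

(** At a leaf the walk turns round, so the dart [(p, x)] is followed by [(x, p)]. Starting from the
    latter shifts the count by one and absorbs the condition [0 < k]. *)
Lemma leaf_succE x y : leaf_succ t rho x y <-> succ_leaf x y.
Proof.
split=> [[lx [ly [p [k [tpx [k0 [ek Lk]]]]]]]|[lx [p txp L]]].
  split=> //; have txp : t x p by rewrite symt.
  exists p => //; apply/lands_iter; case: k k0 ek Lk => // k _ ek Lk; exists k.
  have E j : iter j.+1 (next_dart rho) (p, x) = iter j (next_dart rho) (x, p).
    by rewrite iterSr /next_dart /= (rho_leaf lx txp).
  by split=> // [|j ltj]; rewrite -E // Lk.
split=> //; split; first exact: lands_leaf L.
have [k [ek _ Lk]] := (lands_iter _ _).1 L.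
have E j : iter j.+1 (next_dart rho) (p, x) = iter j (next_dart rho) (x, p).
  by rewrite iterSr /next_dart /= (rho_leaf lx txp).
exists p, k.+1; rewrite symt E; split=> //; split=> //; split=> // -[|j] // ltj.
by rewrite E; apply: Lk.
Qed.

Lemma succ_leaf_fun x y z : succ_leaf x y -> succ_leaf x z -> y = z.
Proof.
move=> [lx [p txp L]] [_ [q txq]]; rewrite -(leaf_nbr lx txp txq).
exact: lands_fun L.
Qed.

(* At an internal vertex the face walk never backtracks, so it is a geodesic of the tree. *)
Lemma lands_side d y : t d.1 d.2 -> lands d y -> y \in side t d.1 d.2.
Proof.
move=> td L; elim: L td => {d y} [d _ _|[u v] y /= lv _ IH tuv]; first exact: side_refl.
have tvu : t v u by rewrite symt.
have tvr := rho_adj rot tvu.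
by apply: (side_sub tree_t tuv tvr _ (IH tvr)); apply: rho_leafN.
Qed.

(** Describes the last turn of the walk: it reaches [y] from [p], having come from [u]. The starting
    point stays behind the current dart because the side left behind only grows. *)
Lemma lands_back d x y : t d.1 d.2 -> ~~ leaf t d.2 -> lands d y ->
  x \in side t d.2 d.1 ->
  exists p u, [/\ t p y, t p u, rho p u = y & x \in side t p u].
Proof.
move=> td ld L; elim: L td ld => {d y} [d ->//|[u v] y /= lv L IH tuv _ xS].
have tvu : t v u by rewrite symt.
have tvr : t v (rho v u) by apply: (rho_adj rot).
have [lr|lr] := boolP (leaf t (rho v u)).
  have ly := lands_fun L (lands_here (d := (v, rho v u)) lr).
  by exists v, u; rewrite ly.
apply: IH => //; apply: (side_sub tree_t) xS => //; rewrite 1?symt //.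
by rewrite eq_sym rho_leafN.
Qed.

(** With [pred_leaf_side] this locates the two outer neighbours of a leaf: they lie beyond the next
    and the previous edge in the rotation at its parent. *)
Lemma succ_leaf_side x y p : succ_leaf x y -> t x p -> y \in side t p (rho p x).
Proof.
move=> [lx [q txq L]] txp; rewrite (leaf_nbr lx txp txq) {p txp}.
have lq := leaf_parentN lx txq.
case: L lq => [->//|{}y _ /= L lq]; apply: (lands_side _ L) => /=.
by apply: (rho_adj rot); rewrite symt.
Qed.

Lemma pred_leaf_side x y p : succ_leaf x y -> t y p ->
  exists u, [/\ t p u, rho p u = y & x \in side t p u].
Proof.
move=> [lx [q txq L]] typ; have ly := lands_leaf L.
have [||p' [u [tp'y tp'u ruy xS]]] := @lands_back (x, q) x y txq _ L.
  exact: leaf_parentN lx txq.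
  exact: side_refl.
have -> : p = p' by apply: leaf_nbr ly typ _; rewrite symt.
by exists u.
Qed.

Variable e : rel V.
Hypothesis eE : forall x y, e x y <-> t x y \/ leaf_succ t rho x y \/ leaf_succ t rho y x.

Lemma halin_edge x y : e x y <-> t x y \/ succ_leaf x y \/ succ_leaf y x.
Proof. by rewrite eE !leaf_succE. Qed.

Lemma internal_adj v u : ~~ leaf t v -> e v u = t v u.
Proof.
move=> lv; apply/idP/idP => [/halin_edge[//|[[]|[_ [p _ /lands_leaf]]]]|tvu].
- by rewrite (negPf lv).
- by rewrite (negPf lv).
- by apply/halin_edge; left.
Qed.

Lemma internal_deg v : ~~ leaf t v -> deg e v = deg t v.
Proof. by move=> lv; apply: eq_card => u; rewrite !inE internal_adj. Qed.

Definition leaf_nbrs p := [set w | t p w & leaf t w].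

Definition crossers p q :=
  [set w | [&& t p w, w != q & [exists y, (y \in side t p q) && e w y]]].

(** The edge from [w] into the other side is not a tree edge, since [pq] is the only one between the
    sides. So it is an outer edge at a leaf, and it leads beyond an edge next to [w] in the rotation
    at [p], which must be [pq]. *)
Lemma crossersP p q w : t p q -> w \in crossers p q ->
  [/\ leaf t w, t p w & rho p w = q \/ w = rho p q].
Proof.
move=> tpq; rewrite inE => /and3P[tpw wq /existsP[y /andP[yS /halin_edge ewy]]].
have twp : t w p by rewrite symt.
have tqp : t q p by rewrite symt.
have wS : w \in side t q p by apply: (side_adj tree_t).
case: ewy => [twy|[ewy|eyw]].
- have wS' := side_disjoint tree_t tqp wS.
  have [ep] := side_cross tree_t tpq yS wS' (etrans (symt _ _) twy).
  by move=> wp; move: tpw; rewrite wp irrt.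
- have lw : leaf t w by case: ewy.
  split=> //; left; apply/eqP; apply: contraLR yS => rq.
  by apply: (side_disjoint_nbr tree_t _ tpq rq (succ_leaf_side ewy twp)); apply: (rho_adj rot).
- have lw : leaf t w by case: eyw => _ [? _ /lands_leaf].
  split=> //; right; have [u [tpu ruw yS']] := pred_leaf_side eyw twp.
  rewrite -ruw; congr rho; apply/eqP; apply: contraLR yS => uq.
  exact: (side_disjoint_nbr tree_t tpu tpq uq yS').
Qed.

Lemma card_crossers p q : t p q -> (#|crossers p q| <= minn 2 #|leaf_nbrs p|)%N.
Proof.
move=> tpq; rewrite leq_min; apply/andP; split; last first.
  apply: subset_leq_card; apply/fintype.subsetP => w /(crossersP tpq)[lw tpw _].
  by rewrite inE tpw.
have : (#|[set w | t p w & rho p w == q]| <= 1)%N.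
  apply/fintype.card_le1_eqP => a b; rewrite !inE => /andP[ta /eqP ra] /andP[tb /eqP rb].
  by apply: (rho_inj rot tb ta); rewrite ra.
suff : (#|crossers p q| <= #|[set w | t p w & rho p w == q]| + #|[set rho p q]|)%N.
  by rewrite cards1; lia.
apply: leq_trans (leq_card_setU _ _); apply: subset_leq_card.
apply/fintype.subsetP => w /(crossersP tpq)[_ tpw rw]; rewrite !inE tpw /=.
by case: rw => ->; rewrite eqxx ?orbT.
Qed.

(* Only the edges between the two sides constrain this function, and their endpoints get
   the values 0 and 1. Hence it is 1-Lipschitz whatever the rest of the graph is. *)
Let cut_fun p q w : int :=
  (if w \in side t p q then
    if t q w && ~~ [exists y, (y \in side t q p) && e w y] then 2 else 1
  else if t p w && ~~ [exists y, (y \in side t p q) && e w y] then -1 else 0)%R.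

Lemma sum_crossers p q : t p q ->
  (\sum_(w | t p w && (w != q)) (1 - (w \in crossers p q)%:R) =
   (deg t p)%:Z - 1 - (#|crossers p q|)%:Z :> int)%R.
Proof.
move=> tpq; rewrite sumrB -natr_sum sumr_const !natz.
have -> : (\sum_(w | t p w && (w != q)) (w \in crossers p q) = #|crossers p q|)%N.
  rewrite -sum1_card [RHS]big_mkcond [LHS]big_mkcond; apply: eq_bigr => w _.
  by rewrite inE; case: (t p w); case: (w != q); case: [exists _, _].
congr (_ - _)%R.
have := cardD1 q [set w | t p w]; rewrite inE tpq -/(deg t p) => ->.
rewrite (_ : #|_| = #|[predD1 [set w | t p w] & q]|); first by lia.
by apply: eq_card => w; rewrite !inE andbC.
Qed.

(** Let a and b be the numbers of crossers at [p] and [q]. The Laplacian sums of [cut_fun] are 2 -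
    deg p + a at [p] and deg q - 2 - b at [q]; positive curvature of [pq] then gives the claim
    through the bounds on a and b. *)
Lemma cut_inequality p q : curv_pos e -> t p q -> ~~ leaf t p -> ~~ leaf t q ->
  (2 * (deg t p * deg t q) < (2 + minn 2 #|leaf_nbrs p|) * deg t q +
                             (2 + minn 2 #|leaf_nbrs q|) * deg t p)%N.
Proof.
move=> pos tpq lp lq; have tqp : t q p by rewrite symt.
have epq : e p q by rewrite internal_adj.
have eqp : e q p by rewrite internal_adj.
have pS : p \in side t q p := side_refl _ _ _.
have qS : q \in side t p q := side_refl _ _ _.
have sideN x : x \in side t q p -> x \notin side t p q by apply: side_disjoint.
have sideNN x : x \notin side t p q -> x \in side t q p.
  by have := side_cover tree_t x tpq; rewrite finset.in_setU => /orP[->|].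
have fp : cut_fun p q p = 0%R.
  by rewrite /cut_fun (negPf (sideN _ pS)) irrt.
have fq : cut_fun p q q = 1%R by rewrite /cut_fun qS irrt.
have symE x y : e x y = e y x.
  by apply/idP/idP => /halin_edge E; apply/halin_edge; rewrite symt; tauto.
have Lf : lip1 e (cut_fun p q).
  move=> x y exy; rewrite /cut_fun.
  have [xS|xS] := boolP (x \in side t p q); have [yS|yS] := boolP (y \in side t p q).
  - by do 2! case: ifP.
  - by do 2! case: ifP.
  - have -> : [exists z, (z \in side t p q) && e x z] by apply/existsP; exists y; rewrite yS.
    have -> : [exists z, (z \in side t q p) && e y z].
      by apply/existsP; exists x; rewrite symE exy andbT sideNN.
    by rewrite !andbF.
  - by do 2! case: ifP.
have := pos p q _ epq Lf; rewrite fp fq => /(_ erefl); rewrite !internal_deg //.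
have sumq : (\sum_(w | e q w) (cut_fun p q w - 1) =
             (deg t q)%:Z - 2 - (#|crossers q p|)%:Z :> int)%R.
  rewrite (eq_bigl (t q)) => [|w]; last exact: internal_adj.
  rewrite (bigD1 p) //= fp; have := sum_crossers tqp.
  rewrite [X in (X = _)%R -> _](_ : _ = \sum_(i | t q i && (i != p)) (cut_fun p q i - 1))%R.
    by move=> ->; lia.
  apply: eq_bigr => w /andP[tqw wp]; have wS := side_adj tree_t tpq tqw wp.
  by rewrite /cut_fun wS !inE tqw wp /=; case: [exists _, _].
have sump : (\sum_(w | e p w) (cut_fun p q w - 0) =
             2 - (deg t p)%:Z + (#|crossers p q|)%:Z :> int)%R.
  rewrite (eq_bigl (t p)) => [|w]; last exact: internal_adj.
  rewrite (bigD1 q) //= fq; have := sum_crossers tpq.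
  rewrite [X in (X = _)%R -> _](_ : _ = - \sum_(i | t p i && (i != q)) (cut_fun p q i - 0))%R.
    by move: (\sum_(_ | _) _)%R => S; lia.
  rewrite -sumrN; apply: eq_bigr => w /andP[tpw wq].
  have /sideN/negPf wS := side_adj tree_t tqp tpw wq.
  by rewrite /cut_fun wS !inE tpw wq /=; case: [exists _, _].
rewrite sumq sump; have := card_crossers tpq; have := card_crossers tqp.
move: (deg t p) (deg t q) #|crossers p q| #|crossers q p| (minn _ _) (minn _ _).
move=> dp dq a b c d; nia.
Qed.

End FaceWalk.

(** * Branches and the hub *)

(* The shape of a component of the tree minus the hub. Its vertices are numbered from the
   root 0; the leaves of [Fork] are 1 and 2 in rotation order, and [Stem b] puts a vertex
   of degree two on top of [b]. *)
Inductive branch := Leaf | Fork | Stem of branch.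

Fixpoint bsize b := match b with Leaf => 1 | Fork => 3 | Stem b => (bsize b).+1 end.
(** [bfirst] and [blast] number the leaves that the face walk meets first and last in the branch. *)
Fixpoint bfirst b := match b with Leaf => 0 | Fork => 1 | Stem b => (bfirst b).+1 end.
Fixpoint blast b := match b with Leaf => 0 | Fork => 2 | Stem b => (blast b).+1 end.

Fixpoint btree b j k : bool :=
  match b, j, k with
  | Fork, 0, 1 | Fork, 0, 2 | Stem _, 0, 1 => true
  | Stem b, j.+1, k.+1 => btree b j k
  | _, _, _ => false
  end.

Fixpoint bchord b j k : bool :=
  match b, j, k with
  | Fork, 1, 2 => true
  | Stem b, j.+1, k.+1 => bchord b j k
  | _, _, _ => false
  end.

Section Branches.
Variables (V : finType) (t : rel V) (rho : V -> V -> V).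
Hypotheses (tree_t : is_tree t) (rot : rotation_system t rho).
Hypothesis branching : exists v, (3 <= deg t v)%N.
Implicit Types (u v w x y h q : V) (b : branch).

Let symt : symmetric t. Proof. by case: tree_t => -[]. Qed.
Let irrt : irreflexive t. Proof. by case: tree_t => -[]. Qed.

(** [h] is the parent of the root [q] and lies outside the branch; the rotation at [q], read from
    [h] on, fixes the numbering. *)
Fixpoint bverts h q b : seq V :=
  match b with
  | Leaf => [:: q]
  | Fork => [:: q; rho q h; rho q (rho q h)]
  | Stem b => q :: bverts q (rho q h) b
  end.

Fixpoint is_branch h q b : Prop :=
  match b with
  | Leaf => t h q /\ leaf t q
  | Fork => [/\ t h q, deg t q = 3, leaf t (rho q h) & leaf t (rho q (rho q h))]
  | Stem b => [/\ t h q, deg t q = 2 & is_branch q (rho q h) b]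
  end.

Lemma is_branch_adj h q b : is_branch h q b -> t h q.
Proof. by case: b => [|| b] []. Qed.

Lemma size_bverts h q b : size (bverts h q b) = bsize b.
Proof. by elim: b h q => //= b IHb h q; rewrite IHb. Qed.

Lemma nth_bverts0 x0 h q b : nth x0 (bverts h q b) 0 = q.
Proof. by case: b. Qed.

Lemma deg2_nbr q h x : deg t q = 2 -> t q h -> t q x -> x = h \/ x = rho q h.
Proof.
move=> dq tqh /(mem_traject_rho rot tqh); rewrite dq /= !inE.
by case/orP=> /eqP->; [left|right].
Qed.

Lemma deg2_rho q h : deg t q = 2 -> t q h -> [/\ t q (rho q h), rho q h != h & rho q (rho q h) = h].
Proof.
move=> dq tqh; split; [exact: (rho_adj rot)|by apply: (rho_neq rot); rewrite ?dq|].
by have := iter_deg_rho rot tqh; rewrite dq.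
Qed.

Lemma deg3_nbr q h x : deg t q = 3 -> t q h -> t q x ->
  [\/ x = h, x = rho q h | x = rho q (rho q h)].
Proof.
move=> dq tqh /(mem_traject_rho rot tqh); rewrite dq /= !inE.
by case/or3P=> /eqP->; [constructor 1|constructor 2|constructor 3].
Qed.

Lemma deg3_rho q h : deg t q = 3 -> t q h ->
  [/\ t q (rho q h), t q (rho q (rho q h)), uniq [:: h; rho q h; rho q (rho q h)] &
     rho q (rho q (rho q h)) = h].
Proof.
move=> dq tqh; have tqr := rho_adj rot tqh; split=> //; first exact: (rho_adj rot).
  by have := uniq_traject_rho rot tqh; rewrite dq.
by have := iter_deg_rho rot tqh; rewrite dq.
Qed.

Lemma bverts_side h q b x : is_branch h q b -> x \in bverts h q b -> x \in side t h q.
Proof.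
elim: b h q => [h q _|h q [thq dq _ _]|b IHb h q [thq dq Bb]] /=.
- move=> xq; have /eqP-> : x == q by move: xq; rewrite inE.
  exact: side_refl.
- have [||tqa tqb /and3P[n _ _] _] := @deg3_rho q h => //; first by rewrite symt.
  have [n1 n2] : rho q h != h /\ rho q (rho q h) != h.
    by move: n; rewrite !inE negb_or ![h == _]eq_sym => /andP[].
  move=> xS; have /or3P[/eqP->|/eqP->|/eqP->] : [|| x == q, x == rho q h | x == rho q (rho q h)].
  + by move: xS; rewrite !inE.
  + exact: side_refl.
  + exact: (side_adj tree_t).
  + exact: (side_adj tree_t).
- move=> xS; have /orP[/eqP->|/(IHb _ _ Bb)] : (x == q) || (x \in bverts q (rho q h) b).
  + by move: xS; rewrite inE.
  + exact: side_refl.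
  have [||tqa n _] := @deg2_rho q h => //; first by rewrite symt.
  exact: (side_sub tree_t).
Qed.

Lemma bverts_uniq h q b : is_branch h q b -> uniq (bverts h q b).
Proof.
elim: b h q => [//|h q [thq dq _ _]|b IHb h q [thq dq Bb]].
  have [||tqa tqb] := @deg3_rho q h => //; first by rewrite symt.
  rewrite /= !inE => /and3P[_ n3 _] _; rewrite n3 !andbT negb_or.
  apply/andP; split.
    by apply/eqP=> eq_q; move: tqa; rewrite -eq_q irrt.
  by apply/eqP=> eq_q; move: tqb; rewrite -eq_q irrt.
rewrite /= IHb // andbT; apply/negP => /(bverts_side Bb).
by apply/negP; apply: (side_root tree_t); apply: is_branch_adj Bb.
Qed.

Lemma bverts_closed h q b x y : is_branch h q b -> x \in bverts h q b -> t x y ->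
  y \in bverts h q b \/ (x = q /\ y = h).
Proof.
elim: b h q => [h q [thq lq]|h q [thq dq la lb]|b IHb h q [thq dq Bb]] /=;
  have tqh : t q h by rewrite symt.
- rewrite !inE => /eqP-> tqy; right; split=> //; exact: leaf_nbr lq tqy tqh.
- have [tqa tqb _ _] := deg3_rho dq tqh.
  rewrite !inE => /or3P[] /eqP-> txy.
  + by case: (deg3_nbr dq tqh txy) => ->; rewrite ?eqxx ?orbT; auto.
  + by left; rewrite (leaf_nbr la txy (etrans (symt _ _) tqa)) eqxx.
  + by left; rewrite (leaf_nbr lb txy (etrans (symt _ _) tqb)) eqxx.
- rewrite !inE => /orP[/eqP->|xS] txy.
    have [->|->] := deg2_nbr dq tqh txy; first by right.
    by left; rewrite -{2}(nth_bverts0 q q (rho q h) b) mem_nth ?orbT // size_bverts; case: (b).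
  by case: (IHb _ _ Bb xS txy) => [->|[_ ->]]; left; rewrite ?eqxx ?orbT.
Qed.

Lemma leafN_gt1 v : (1 < deg t v)%N -> ~~ leaf t v.
Proof. by rewrite /leaf; lia. Qed.

Lemma lands_bfirst x0 h q b :
  is_branch h q b -> lands t rho (h, q) (nth x0 (bverts h q b) (bfirst b)).
Proof.
elim: b h q => [h q [thq lq]|h q [thq dq la lb]|b IHb h q [thq dq Bb]] /=.
- exact: (@lands_here _ t rho (h, q)).
- apply: lands_next => /=; first by rewrite leafN_gt1 ?dq.
  exact: (@lands_here _ t rho (q, rho q h)).
- apply: lands_next => /=; first by rewrite leafN_gt1 ?dq.
  exact: IHb.
Qed.

(** After the last leaf the rotation at each vertex on the way back leads to its parent, so the walk
    leaves the branch by the dart [(q, h)]. *)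
Lemma succ_blast x0 h q b y : is_branch h q b -> lands t rho (q, h) y ->
  succ_leaf t rho (nth x0 (bverts h q b) (blast b)) y.
Proof.
elim: b h q => [h q [thq lq]|h q [thq dq la lb]|b IHb h q [thq dq Bb]] /=;
  have tqh : t q h by rewrite symt.
- by move=> L; split=> //; exists h.
- have [tqa tqb _ rb] := deg3_rho dq tqh; move=> L; split=> //; exists q; first by rewrite symt.
  by apply: lands_next => /=; rewrite ?leafN_gt1 ?dq ?rb.
- move=> L; apply: IHb => //; have [_ _ rh] := deg2_rho dq tqh.
  by apply: lands_next => /=; rewrite ?leafN_gt1 ?dq ?rh.
Qed.

(** Each leaf of a branch thus has a successor known by its code; [place_succ] deduces that there is
    no other. *)
Lemma leaf_bverts x0 h q b j : is_branch h q b -> (j < bsize b)%N ->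
  leaf t (nth x0 (bverts h q b) j) ->
  j = blast b \/ exists2 k, (k < bsize b)%N & bchord b j k.
Proof.
elim: b h q j => [h q [|j] //|h q [|[|[|j]]] //|b IHb h q [|j]] /=; auto.
- by case=> _ dq _ _ _; rewrite (negPf (leafN_gt1 _)) ?dq.
- by move=> _ _ _; right; exists 2.
- by case=> _ dq _ _; rewrite (negPf (leafN_gt1 _)) ?dq.
- case=> _ _ Bb; rewrite ltnS => ltj lj.
  by have [->|[k ltk c]] := IHb _ _ _ Bb ltj lj; [left|right; exists k.+1].
Qed.

Lemma succ_bchord x0 h q b j k : is_branch h q b -> bchord b j k ->
  succ_leaf t rho (nth x0 (bverts h q b) j) (nth x0 (bverts h q b) k).
Proof.
elim: b h q j k => [h q [|j] k _|h q [|[|[|j]]] [|[|[|k]]]|b IHb h q [|j] [|k]] //=;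
  last by case=> _ _ /IHb; apply.
case=> thq dq la lb _; have tqh : t q h by rewrite symt.
have [tqa tqb _ rb] := deg3_rho dq tqh.
split=> //; exists q; first by rewrite symt.
apply: lands_next => /=; first by rewrite leafN_gt1 ?dq.
exact: (@lands_here _ t rho (q, rho q (rho q h))).
Qed.

Lemma btree_bverts x0 h q b j k : is_branch h q b -> (j < bsize b)%N -> (k < bsize b)%N ->
  t (nth x0 (bverts h q b) j) (nth x0 (bverts h q b) k) = btree b j k || btree b k j.
Proof.
elim: b h q j k => [h q [|j] [|k]|h q j k|b IHb h q j k].
1-4: by rewrite /= ?irrt.
- move=> Bb; have := Bb => -[thq dq la lb]; have tqh : t q h by rewrite symt.
  have [tqa tqb /andP[]] := deg3_rho dq tqh; rewrite /= inE => _ /andP[n _] _.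
  have taq : t (rho q h) q by rewrite symt.
  have tbq : t (rho q (rho q h)) q by rewrite symt.
  have nab : t (rho q h) (rho q (rho q h)) = false.
    by apply/negP => /(leaf_parentN tree_t branching la)/negP.
  have nba : t (rho q (rho q h)) (rho q h) = false by rewrite symt.
  by case: j k => [|[|[|j]]] [|[|[|k]]] //=; rewrite ?irrt.
- move=> [thq dq Bb]; have tqh : t q h by rewrite symt.
  have [tqa n _] := deg2_rho dq tqh.
  have key k' : (k' < bsize b)%N -> t q (nth x0 (bverts q (rho q h) b) k') = (k' == 0).
    move=> ltk'; apply/idP/eqP => [tqx|->]; last by rewrite nth_bverts0.
    have xS : nth x0 (bverts q (rho q h) b) k' \in bverts q (rho q h) b.
      by rewrite mem_nth ?size_bverts.
    have [ex|ex] := deg2_nbr dq tqh tqx.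
      move: (bverts_side Bb xS); rewrite ex => hS.
      have := side_step tree_t tqa hS (etrans (symt _ _) tqh).
      have : h \in side t q (rho q h) by [].
      move: (side_disjoint_nbr tree_t tqa tqh n hS).
      by rewrite side_refl.
    apply/eqP; rewrite -(nth_uniq x0 _ _ (bverts_uniq Bb)) ?size_bverts // ?nth_bverts0 ?ex //.
    by case: (b).
  case: j k => [|j] [|k] /=; rewrite ?ltnS.
  + by rewrite irrt.
  + by move=> _ /key->; case: k.
  + by rewrite symt => /key-> _; case: j.
  + exact: IHb.
Qed.
End Branches.

(** * Shape of the tree under positive curvature *)

Section Classification.
Variables (V : finType) (t : rel V) (rho : V -> V -> V) (e : rel V).
Hypotheses (tree_t : is_tree t) (rot : rotation_system t rho).
Hypothesis branching : exists v, (3 <= deg t v)%N.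
Hypothesis eE : forall x y, e x y <-> t x y \/ leaf_succ t rho x y \/ leaf_succ t rho y x.
Hypothesis pos : curv_pos e.
Implicit Types (u v x y z h p q : V) (w : seq branch).

Let symt : symmetric t. Proof. by case: tree_t => -[]. Qed.

Let cutP p q : t p q -> ~~ leaf t p -> ~~ leaf t q ->
  (2 * (deg t p * deg t q) < (2 + minn 2 #|leaf_nbrs t p|) * deg t q +
                             (2 + minn 2 #|leaf_nbrs t q|) * deg t p)%N.
Proof. by move=> tpq; apply: (cut_inequality tree_t rot branching eE pos tpq). Qed.

Lemma leaf_nbrs_fork p q : t p q -> ~~ leaf t q -> deg t p = 3 ->
  (1 < #|leaf_nbrs t p|)%N -> is_branch t rho q p Fork.
Proof.
move=> tpq lq dp L; have [tpa tpb _ _] := deg3_rho rot dp tpq.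
have sub : leaf_nbrs t p \subset [set rho p q; rho p (rho p q)].
  apply/fintype.subsetP => x; rewrite !inE => /andP[tpx lx].
  by case: (deg3_nbr rot dp tpq tpx) lx => ->; rewrite ?eqxx ?orbT // (negPf lq).
have/eqP E : leaf_nbrs t p == [set rho p q; rho p (rho p q)].
  by rewrite finset.eqEcard sub (leq_trans _ L) // cards2; case: (_ == _).
have : rho p q \in leaf_nbrs t p by rewrite E !inE eqxx.
have : rho p (rho p q) \in leaf_nbrs t p by rewrite E !inE eqxx orbT.
by rewrite !inE => /andP[_ lb] /andP[_ la]; split; rewrite // symt.
Qed.

Lemma leaf_nbrs_stem p q : t p q -> ~~ leaf t q -> deg t p = 2 ->
  (0 < #|leaf_nbrs t p|)%N -> is_branch t rho q p (Stem Leaf).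
Proof.
move=> tpq lq dp /card_gt0P[x]; rewrite inE => /andP[tpx lx].
split=> //; [by rewrite symt|split; first exact: (rho_adj rot)].
by case: (deg2_nbr rot dp tpq tpx) lx => ->; rewrite ?(negPf lq).
Qed.

Lemma fork_leaf_nbrs h q x : is_branch t rho h q Fork -> t q x -> ~~ leaf t x -> x = h.
Proof.
move=> [thq dq la lb] tqx lx; have tqh : t q h by rewrite symt.
by case: (deg3_nbr rot dq tqh tqx) lx => -> //; rewrite ?la ?lb.
Qed.

(** Dividing the cut inequality by both degrees, one of (2 + a) / deg p and (2 + b) / deg q exceeds
    1, where a and b are at most 2. For degrees at least 3 this forces degree 3 and two leaf
    neighbours. *)
Lemma big_big_edge p q : t p q -> (3 <= deg t p)%N -> (3 <= deg t q)%N ->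
  is_branch t rho q p Fork \/ is_branch t rho p q Fork.
Proof.
move=> tpq dp dq; have tqp : t q p by rewrite symt.
have lp : ~~ leaf t p by rewrite leafN_gt1 // ltnW.
have lq : ~~ leaf t q by rewrite leafN_gt1 // ltnW.
have := cutP tpq lp lq; move: (@leaf_nbrs_fork p q) (@leaf_nbrs_fork q p).
move: #|leaf_nbrs t p| #|leaf_nbrs t q| => a b F1 F2 ineq.
suff [[d1 a1]|[d2 b2]] : (deg t p = 3 /\ 1 < a) \/ (deg t q = 3 /\ 1 < b).
- by left; apply: F1.
- by right; apply: F2.
move: (deg t p) (deg t q) dp dq ineq {F1 F2} => m n dp dq ineq.
have [|a2] := leqP a 1; have [|b2] := leqP b 1; move=> *.
- by nia.
- by right; split=> //; nia.
- by left; split=> //; nia.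
- have [->|m3] := eqVneq m 3; first by left.
  by right; split=> //; nia.
Qed.

(** With degree 3 at [q] and both minima at most 2, the cut inequality implies 6m < 12 + 4m for m
    the degree of [h]. *)
Lemma fork_deg h q : is_branch t rho h q Fork -> (3 <= deg t h)%N -> (deg t h <= 5)%N.
Proof.
move=> B dh; have [thq dq _ _] := B.
have lh : ~~ leaf t h by rewrite leafN_gt1 // ltnW.
have lq : ~~ leaf t q by rewrite leafN_gt1 // dq.
have := cutP thq lh lq; rewrite dq.
move: (deg t h) #|_| #|_| => m a b; nia.
Qed.

(** Without leaves at [p] the cut inequality reads deg q < 2 + min(2, b), b being the number of
    leaves at [q]. So [q] has degree 2 and a leaf, or degree 3 and two leaves. *)
Lemma deg2_internal p q : deg t p = 2 -> t p q -> ~~ leaf t q -> ~~ leaf t (rho p q) ->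
  is_branch t rho p q (Stem Leaf) \/ is_branch t rho p q Fork.
Proof.
move=> dp tpq lq lr; have lp : ~~ leaf t p by rewrite leafN_gt1 ?dp.
have tqp : t q p by rewrite symt.
have E : #|leaf_nbrs t p| = 0.
  apply: eq_card0 => x; rewrite inE; apply/negP => /andP[tpx lx].
  by case: (deg2_nbr rot dp tpq tpx) lx => -> ; apply/negP.
have := cutP tpq lp lq; rewrite E dp => ineq.
have dq := leafN_deg tqp lq.
have [d2|d2] := eqVneq (deg t q) 2.
  left; apply: leaf_nbrs_stem => //; rewrite d2 in ineq.
  by move: #|_| ineq => a; nia.
right; apply: leaf_nbrs_fork => //; move: (deg t q) #|_| dq d2 ineq => m a; nia.
Qed.

(* A tree with two such branches at a vertex of degree two is a path. *)
Lemma deg2_fork p q : deg t p = 2 -> t p q -> is_branch t rho p q (Stem Leaf) ->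
  is_branch t rho p (rho p q) (Stem Leaf) -> False.
Proof.
move=> dp tpq B1 B2; have [v dv] := branching.
pose A := p :: bverts rho p q (Stem Leaf) ++ bverts rho p (rho p q) (Stem Leaf).
have memA z : (z \in A) = [|| z == p, z \in bverts rho p q (Stem Leaf) |
    z \in bverts rho p (rho p q) (Stem Leaf)] by rewrite in_cons mem_cat.
have : v \in A.
  apply: (closed_connected (r := t) (x0 := p)); [by case: tree_t => _ []|exact: mem_head|].
  move=> x y; rewrite !memA => /or3P[/eqP->|xA|xA] txy.
  - by case: (deg2_nbr rot dp tpq txy) => ->; rewrite mem_head ?orbT.
  - by case: (bverts_closed tree_t rot B1 xA txy) => [->|[_ ->]]; rewrite ?eqxx ?orbT.
  - by case: (bverts_closed tree_t rot B2 xA txy) => [->|[_ ->]]; rewrite ?eqxx ?orbT.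
case: B1 => /= _ d1 [_ l1]; case: B2 => /= _ d2 [_ l2].
rewrite /A /= !inE => /or3P[/eqP|/eqP|/or3P[] /eqP] ev; move: dv; rewrite ev ?dp ?d1 ?d2 //.
  by rewrite (eqP l1).
by rewrite (eqP l2).
Qed.

Definition hub_of (h q : V) (w : seq branch) : Prop :=
  [/\ t h q, (3 <= deg t h)%N, size w = deg t h &
   forall i, (i < size w)%N -> is_branch t rho h (iter i (rho h) q) (nth Leaf w i)].

(** By [deg2_fork] one of the two branches at [p] is a fork. Its root becomes the hub, its two
    leaves are spokes, and [p] carries the other branch as a stem. *)
Lemma hub_deg2 p q : deg t p = 2 -> t p q -> ~~ leaf t q -> ~~ leaf t (rho p q) ->
  exists h q' b, (b = Stem Leaf \/ b = Fork) /\ hub_of h q' [:: Stem b; Leaf; Leaf].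
Proof.
move=> dp tpq lq lr; have [tpr n rr] := deg2_rho rot dp tpq.
have hub q0 b : t p q0 -> is_branch t rho p q0 Fork -> is_branch t rho p (rho p q0) b ->
    hub_of q0 p [:: Stem b; Leaf; Leaf].
  move=> tpq0 [_ dq0 la lb] Bb; have tq0p : t q0 p by rewrite symt.
  have [ta tb _ _] := deg3_rho rot dq0 tq0p.
  by split; rewrite ?dq0 // => -[|[|[|i]]].
have B1 := deg2_internal dp tpq lq lr.
have B2 : is_branch t rho p (rho p q) (Stem Leaf) \/ is_branch t rho p (rho p q) Fork.
  by apply: deg2_internal; rewrite ?rr.
case: B1 => B1.
  case: B2 => B2; first by case: (deg2_fork dp tpq B1 B2).
  exists (rho p q), p, (Stem Leaf); split; first by left.
  by apply: hub; rewrite ?rr.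
case: B2 => B2.
  by exists q, p, (Stem Leaf); split; [left|apply: hub].
by exists q, p, Fork; split; [right|apply: hub].
Qed.

(** If two vertices of degree at least 3 are adjacent, one is a fork seen from the other, and the
    other is the hub. If there are none, every vertex of degree at least 3 will do. *)
Lemma exists_hub : exists2 h, (3 <= deg t h)%N &
  forall z, t h z -> (3 <= deg t z)%N -> is_branch t rho h z Fork.
Proof.
have [/existsP[p /existsP[q /and3P[tpq dp dq]]]|no] :=
    boolP [exists p, [exists q, [&& t p q, 3 <= deg t p & 3 <= deg t q]]]; last first.
  have [v dv] := branching; exists v => // z tvz dz; case/negP: no.
  by apply/existsP; exists v; apply/existsP; exists z; rewrite tvz dv.
wlog B : p q tpq dp dq / is_branch t rho q p Fork.
  move=> W; case: (big_big_edge tpq dp dq) => B; first exact: (W p q).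
  by apply: (W q p) => //; rewrite symt.
exists q => // z tqz dz; have [//|B'] := big_big_edge (etrans (symt _ _) tqz) dz dq.
(* Otherwise [q] is a fork seen from [z], and [z] is its only internal neighbour; but [p] is
   internal too. *)
suff <- : p = z by [].
apply: fork_leaf_nbrs B' _ _; first by rewrite symt.
by rewrite leafN_gt1 // ltnW.
Qed.

Definition spoke b := match b with Leaf | Stem Leaf => true | _ => false end.
Definition spoke_or_fork b := if b is Fork then true else spoke b.

(** The cyclic word is read from a fork if there is one, else from a subdivided spoke, so that the
    enumeration may fix the first letter. *)
Definition simple_word (w : seq branch) : Prop :=
  [\/ exists s, [/\ w = Fork :: s, all spoke_or_fork s & (size w <= 5)%N],
      exists s, w = Stem Leaf :: s /\ all spoke s |
      w = nseq (size w) Leaf].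

(** [Fork] is the default value; [hub_simple] has the hypotheses that make it correct. *)
Definition branch_at z := if leaf t z then Leaf else if deg t z == 2 then Stem Leaf else Fork.

Lemma hub_simple h q : (3 <= deg t h)%N -> t h q ->
  (forall z, t h z -> (3 <= deg t z)%N -> is_branch t rho h z Fork) ->
  (forall z, t h z -> deg t z = 2 -> leaf t (rho z h)) ->
  hub_of h q [seq branch_at z | z <- traject (rho h) q (deg t h)].
Proof.
move=> dh thq F S; split; rewrite ?size_map ?size_traject // => i lti.
rewrite (nth_map q) ?size_traject // nth_traject //.
have tz := iter_rho_adj rot i thq; move: (iter _ _ _) tz => z thz.
have tzh : t z h by rewrite symt.
rewrite /branch_at; case: ifPn => lz //; case: eqP => dz.
  by split=> //; split; rewrite ?S //; apply: (rho_adj rot).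
apply: F => //; have := leafN_deg tzh lz; lia.
Qed.

(** A vertex of degree 2 with two internal neighbours leads to [hub_deg2]. Otherwise every neighbour
    of degree 2 of the hub ends in a leaf, and only the letters [Leaf], [Stem Leaf] and [Fork]
    occur. *)
Lemma classification : exists h q w, hub_of h q w /\
  ((exists b, (b = Stem Leaf \/ b = Fork) /\ w = [:: Stem b; Leaf; Leaf]) \/ simple_word w).
Proof.
have [/existsP[p /existsP[q /and4P[/eqP dp tpq lq lr]]]|no] :=
    boolP [exists p, [exists q, [&& deg t p == 2, t p q, ~~ leaf t q & ~~ leaf t (rho p q)]]].
  have [h [q' [b [bE H]]]] := hub_deg2 dp tpq lq lr.
  by exists h, q', [:: Stem b; Leaf; Leaf]; split=> //; left; exists b.
have [h dh F] := exists_hub.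
have lh : ~~ leaf t h by rewrite leafN_gt1 // ltnW.
have S z : t h z -> deg t z = 2 -> leaf t (rho z h).
  move=> thz dz; apply: contraNT no => lz; apply/existsP; exists z; apply/existsP; exists h.
  by rewrite dz eqxx symt thz lh.
have E q : t h q -> [seq branch_at z | z <- traject (rho h) q (deg t h)] =
    branch_at q :: [seq branch_at z | z <- traject (rho h) (rho h q) (deg t h).-1].
  by move=> thq; case: (deg t h) dh.
have tr q z : t h q -> z \in traject (rho h) (rho h q) (deg t h).-1 -> t h z.
  by move=> thq /trajectP[i _ ->]; apply: (iter_rho_adj rot); apply: (rho_adj rot).
have [/existsP[q /andP[thq dq]]|noF] := boolP [exists q, t h q && (3 <= deg t q)%N].
  exists h, q, [seq branch_at z | z <- traject (rho h) q (deg t h)]; split; first exact: hub_simple.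
  right; constructor 1; exists [seq branch_at z | z <- traject (rho h) (rho h q) (deg t h).-1].
  split.
  - rewrite E //; congr cons; rewrite /branch_at.
    by rewrite (negPf (leafN_gt1 _)) ?(ltnW dq) //; case: eqP dq => // ->.
  - by rewrite all_map; apply/allP => z _; rewrite /= /branch_at; case: ifP => // _; case: ifP.
  - by rewrite size_map size_traject; apply: fork_deg (F q thq dq) dh.
have low z : t h z -> branch_at z = Leaf \/ branch_at z = Stem Leaf /\ deg t z = 2.
  move=> thz; have tzh : t z h by rewrite symt.
  rewrite /branch_at; case: ifPn => lz; first by left.
  case: eqP => dz; first by right.
  case/negP: noF; apply/existsP; exists z; rewrite thz /=; have := leafN_deg tzh lz; lia.
have [/existsP[q /andP[thq /eqP dq]]|noS] := boolP [exists q, t h q && (deg t q == 2)].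
  exists h, q, [seq branch_at z | z <- traject (rho h) q (deg t h)]; split; first exact: hub_simple.
  right; constructor 2; exists [seq branch_at z | z <- traject (rho h) (rho h q) (deg t h).-1].
  split.
  - by rewrite E //; congr cons; rewrite /branch_at (negPf (leafN_gt1 _)) ?dq.
  - by rewrite all_map; apply/allP => z /(tr _ _ thq) thz /=; case: (low z thz) => [|[]] ->.
have [q] : exists q, t h q.
  by move/ltnW/ltnW: dh => /card_gt0P[q]; rewrite inE; exists q.
move=> thq; exists h, q, [seq branch_at z | z <- traject (rho h) q (deg t h)].
split; first exact: hub_simple.
right; constructor 3; rewrite size_map.
have : {in traject (rho h) q (deg t h), forall z, branch_at z = Leaf}; last first.
  elim: (traject _ _ _) => //= z s IHs L; rewrite L ?mem_head // IHs // => y ys.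
  by rewrite L // in_cons ys orbT.
move=> z /trajectP[i _ ->].
have thz := iter_rho_adj rot i thq; case: (low _ thz) => [//|[_ dz]].
by case/negP: noS; apply/existsP; exists (iter i (rho h) q); rewrite thz dz.
Qed.

End Classification.

(** * Presentation of the graph by the word of its branches *)

(* The vertex [(i, j)] is the [j]-th vertex of the [i]-th branch, in the order of the
   rotation at the hub; the hub itself is coded by the out-of-range index [(size w, 0)]. *)
Definition hub (w : seq branch) : nat * nat := (size w, 0).

Definition verts (w : seq branch) : seq (nat * nat) :=
  hub w :: [seq (i, j) | i <- iota 0 (size w), j <- iota 0 (bsize (nth Leaf w i))].

Definition tree_arc (w : seq branch) (a b : nat * nat) : bool :=
  (a == hub w) && (b.1 < size w) && (b.2 == 0)
  || [&& a.1 < size w, a.1 == b.1 & btree (nth Leaf w a.1) a.2 b.2].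

Definition leaf_arc (w : seq branch) (a b : nat * nat) : bool :=
  (a.1 < size w) &&
  ((a.1 == b.1) && bchord (nth Leaf w a.1) a.2 b.2
   || [&& b.1 == a.1.+1 %% size w, a.2 == blast (nth Leaf w a.1) &
          b.2 == bfirst (nth Leaf w b.1)]).

Definition arc w a b := tree_arc w a b || leaf_arc w a b.
Definition adj w a b := arc w a b || arc w b a.

Definition presents (V : finType) (e : rel V) (w : seq branch) (G : nat * nat -> V) : Prop :=
  [/\ {in verts w &, injective G}, forall x, x \in [seq G a | a <- verts w] &
      {in verts w &, forall a b, e (G a) (G b) = adj w a b}].

Lemma bfirst_lt b : bfirst b < bsize b. Proof. by elim: b. Qed.
Lemma bchord_lt b j k : bchord b j k -> k < bsize b.
Proof. by elim: b j k => [|[|[|j]] [|[|[|k]]]|b IHb [|j] [|k]] //= /IHb. Qed.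
Lemma bsize_gt0 b : 0 < bsize b. Proof. by case: b. Qed.

Lemma mem_verts w a :
  (a \in verts w) = (a == hub w) || (a.1 < size w) && (a.2 < bsize (nth Leaf w a.1)).
Proof.
rewrite in_cons; congr orb; case: a => i j /=.
apply/allpairsPdep/andP => [[i' [j' []]]|[lti ltj]].
  by rewrite !mem_iota /= => lti ltj [-> ->].
by exists i, j; rewrite !mem_iota.
Qed.

Section Presentation.
Variables (V : finType) (t : rel V) (rho : V -> V -> V) (e : rel V).
Hypotheses (tree_t : is_tree t) (rot : rotation_system t rho).
Hypothesis branching : exists v, (3 <= deg t v)%N.
Hypothesis eE : forall x y, e x y <-> t x y \/ leaf_succ t rho x y \/ leaf_succ t rho y x.
Variables (h q : V) (w : seq branch).
Hypothesis hubw : hub_of t rho h q w.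

Let symt : symmetric t. Proof. by case: tree_t => -[]. Qed.
Let irrt : irreflexive t. Proof. by case: tree_t => -[]. Qed.
Let thq : t h q. Proof. by case: hubw. Qed.
Let sizew : size w = deg t h. Proof. by case: hubw. Qed.
Let gt2w : 2 < size w. Proof. by case: hubw => _ + ->. Qed.
Let gt0w : 0 < size w. Proof. by do 2! apply: ltnW. Qed.
Let isb i : i < size w -> is_branch t rho h (iter i (rho h) q) (nth Leaf w i).
Proof. by case: hubw => _ _ _; apply. Qed.
Let thi i : t h (iter i (rho h) q). Proof. exact: (iter_rho_adj rot). Qed.

Definition place (a : nat * nat) : V :=
  if a.1 == size w then h
  else nth h (bverts rho h (iter a.1 (rho h) q) (nth Leaf w a.1)) a.2.

Lemma place_hub : place (hub w) = h. Proof. by rewrite /place eqxx. Qed.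

Lemma placeE i j : i < size w ->
  place (i, j) = nth h (bverts rho h (iter i (rho h) q) (nth Leaf w i)) j.
Proof. by move=> lti; rewrite /place ltn_eqF. Qed.

Lemma place_mem i j : i < size w -> j < bsize (nth Leaf w i) ->
  place (i, j) \in bverts rho h (iter i (rho h) q) (nth Leaf w i).
Proof. by move=> lti ltj; rewrite placeE // mem_nth // size_bverts. Qed.

Lemma place_side i j : i < size w -> j < bsize (nth Leaf w i) ->
  place (i, j) \in side t h (iter i (rho h) q).
Proof. by move=> lti ltj; apply: (bverts_side tree_t rot (isb lti)); apply: place_mem. Qed.

Lemma place_neq_hub i j : i < size w -> j < bsize (nth Leaf w i) -> place (i, j) <> h.
Proof.
move=> lti ltj eqh; move: (place_side lti ltj); rewrite eqh.
by apply/negP; apply: (side_root tree_t).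
Qed.

Lemma iter_rho_inj i k : i < size w -> k < size w -> iter i (rho h) q = iter k (rho h) q -> i = k.
Proof.
rewrite sizew => lti ltk eqik; apply/eqP.
have := @nth_uniq _ q _ i k _ _ (uniq_traject_rho rot thq).
by rewrite size_traject !nth_traject // eqik eqxx => <-.
Qed.

Lemma place_branch i j k l : i < size w -> j < bsize (nth Leaf w i) ->
  k < size w -> l < bsize (nth Leaf w k) -> place (k, l) \in side t h (iter i (rho h) q) -> i = k.
Proof.
move=> lti ltj ltk ltl inS; apply: iter_rho_inj => //; apply/eqP; apply/negP => n.
have /negP := side_disjoint_nbr tree_t (thi i) (thi k) (introN idP n) inS.
by apply; apply: place_side.
Qed.

Lemma place_inj : {in verts w &, injective place}.
Proof.
move=> [i j] [k l]; rewrite !mem_verts => /orP[/eqP->|/andP[/= lti ltj]];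
  move=> /orP[/eqP->|/andP[/= ltk ltl]] //; rewrite ?place_hub.
- by move/esym/(place_neq_hub ltk ltl).
- by move/(place_neq_hub lti ltj).
move=> eqp; have eik : i = k.
  by apply: (place_branch lti ltj ltk ltl); rewrite -eqp; apply: place_side.
move: eqp ltl; rewrite -{}eik {k ltk} !placeE // => /eqP + ltl.
by rewrite nth_uniq ?size_bverts // ?(bverts_uniq tree_t rot (isb lti)) // => /eqP->.
Qed.

Lemma place_hub_adj i j : i < size w -> j < bsize (nth Leaf w i) -> t h (place (i, j)) = (j == 0).
Proof.
move=> lti ltj; apply/idP/eqP => [thx|->]; last by rewrite placeE // nth_bverts0.
have txh : t (place (i, j)) h by rewrite symt.
have [hS|[+ _]] := bverts_closed tree_t rot (isb lti) (place_mem lti ltj) txh.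
  have := bverts_side tree_t rot (isb lti) hS.
  by rewrite (negPf (side_root tree_t (thi i))).
move/eqP; rewrite placeE // -{2}(nth_bverts0 rho h h (iter i (rho h) q) (nth Leaf w i)).
by rewrite nth_uniq ?size_bverts ?bsize_gt0 ?(bverts_uniq tree_t rot (isb lti)) // => /eqP.
Qed.

Lemma place_tree : {in verts w &, forall a b,
  t (place a) (place b) = tree_arc w a b || tree_arc w b a}.
Proof.
move=> [i j] [k l]; rewrite !mem_verts /tree_arc => /orP[/eqP[-> ->]|/andP[/= lti ltj]];
  move=> /orP[/eqP[-> ->]|/andP[/= ltk ltl]]; rewrite -/(hub w) ?place_hub /= ?ltnn ?eqxx /=.
- by rewrite irrt.
- by rewrite place_hub_adj // ltk xpair_eqE ?(gtn_eqF ltk) ?(ltn_eqF ltk) /= ?andbF ?orbF.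
- by rewrite symt place_hub_adj // lti xpair_eqE ?(gtn_eqF lti) ?(ltn_eqF lti) /= ?andbF ?orbF.
rewrite /hub !xpair_eqE (ltn_eqF lti) (ltn_eqF ltk) lti ltk /=.
have [eik|nik] := eqVneq i k.
  rewrite -eik in ltl *; rewrite !placeE //.
  exact: (btree_bverts tree_t rot branching h (isb lti)).
(* Different branches: a tree edge leaving a side at the hub must end in the hub. *)
apply/negP => txy; have xS := place_side lti ltj.
have yS : place (k, l) \notin side t h (iter i (rho h) q).
  by apply/negP => /(place_branch lti ltj ltk ltl) eik; rewrite eik eqxx in nik.
by have [_ /(place_neq_hub ltk ltl)] := side_cross tree_t (thi i) xS yS txy.
Qed.

(** From the last leaf of a branch the walk returns to the hub, turns once and enters the next
    branch; after the last branch the rotation closes up by [iter_deg_rho]. *)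
Lemma place_leaf_arc a b : a \in verts w -> leaf_arc w a b ->
  succ_leaf t rho (place a) (place b) /\ b \in verts w.
Proof.
case: a b => [i j] [k l] _ /andP[/= lti /orP[/andP[/eqP eik c]|/and3P[/eqP-> /eqP-> /eqP->]]].
  rewrite -eik mem_verts /= lti (bchord_lt c) orbT !placeE //; split=> //.
  by apply: (succ_bchord tree_t rot h (isb lti) c).
have ltk : i.+1 %% size w < size w by rewrite ltn_mod.
rewrite mem_verts /= ltk bfirst_lt orbT !placeE //; split=> //.
apply: (succ_blast tree_t rot h (isb lti)).
apply: lands_next => /=; first by rewrite leafN_gt1 // -sizew ltnW.
have -> : rho h (iter i (rho h) q) = iter (i.+1 %% size w) (rho h) q.
  have [lt|ge] := ltnP i.+1 (size w); first by rewrite modn_small.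
  have -> : i.+1 = size w by apply/eqP; rewrite eqn_leq ge lti.
  rewrite modnn /= -iterS (_ : i.+1 = deg t h) ?(iter_deg_rho rot) // -sizew.
  by apply/eqP; rewrite eqn_leq ge lti.
exact: (lands_bfirst h (isb ltk)).
Qed.

(** Every leaf has a successor among the coded arcs, and successors are unique, so the coded arcs
    are all. *)
Lemma place_succ a b : a \in verts w -> b \in verts w ->
  succ_leaf t rho (place a) (place b) <-> leaf_arc w a b.
Proof.
move=> va vb; split=> [S|/(place_leaf_arc va)[]//].
have det c : leaf_arc w a c -> leaf_arc w a b.
  move=> ac; have [S' vc] := place_leaf_arc va ac.
  by have /place_inj -> := succ_leaf_fun S S'.
have la : leaf t (place a) by case: S.
move: va la det {S}; case: a => i j; rewrite mem_verts => /orP[/eqP->|/andP[/= lti ltj]].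
  by rewrite place_hub (negPf (leafN_gt1 _)) // -sizew ltnW.
rewrite placeE // => /(leaf_bverts (isb lti) ltj)[->|[k ltk c]] det.
  apply: (det (i.+1 %% size w, bfirst (nth Leaf w (i.+1 %% size w)))).
  by rewrite /leaf_arc /= lti !eqxx orbT.
by apply: (det (i, k)); rewrite /leaf_arc /= lti eqxx c.
Qed.

Lemma place_presents : presents e w place.
Proof.
split; first exact: place_inj.
  (* The image contains the hub and is closed under tree adjacency, hence is everything. *)
  apply: (closed_connected (r := t) (x0 := h)); first by case: tree_t => _ [].
    by rewrite -place_hub map_f // mem_verts eqxx.
  move=> _ y /mapP[[i j] va ->]; move: va; rewrite mem_verts => /orP[/eqP->|/andP[]].
    rewrite place_hub => /(mem_traject_rho rot thq)/trajectP[i' + ->]; rewrite -sizew => lti'.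
    have <- : place (i', 0) = iter i' (rho h) q by rewrite placeE // nth_bverts0.
    by rewrite map_f // mem_verts lti' bsize_gt0 orbT.
  rewrite [(i, j).1]/= [(i, j).2]/= => lti ltj txy.
  have [yB|[_ ->]] := bverts_closed tree_t rot (isb lti) (place_mem lti ltj) txy.
    pose k := index y (bverts rho h (iter i (rho h) q) (nth Leaf w i)).
    have <- : place (i, k) = y by rewrite placeE // nth_index.
    by rewrite map_f // mem_verts lti -(size_bverts rho h (iter i (rho h) q)) index_mem yB orbT.
  by rewrite -place_hub map_f // mem_verts eqxx.
move=> a b va vb; apply/idP/idP.
  move/(halin_edge tree_t rot eE); rewrite place_tree // !place_succ // /adj /arc.
  by case=> [/orP[]->|[]->]; rewrite ?orbT.
rewrite /adj /arc => H; apply/(halin_edge tree_t rot eE); rewrite place_tree // !place_succ //.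
by case/orP: H => /orP[]->; rewrite ?orbT; auto.
Qed.

End Presentation.

(** * Curvature of the presented graph *)

Lemma verts_uniq w : uniq (verts w).
Proof.
rewrite /= allpairs_uniq_dep ?iota_uniq //.
- rewrite andbT; apply/allpairsPdep => -[i [j [+ _ [eqi _]]]].
  by rewrite mem_iota -eqi ltnn andbF.
- by move=> i _; apply: iota_uniq.
- by move=> [i j] [k l] _ _ /= [-> ->].
Qed.

Lemma adj_sym w : symmetric (adj w).
Proof. by move=> a b; rewrite /adj orbC. Qed.

Definition nbr_sum w (f : nat * nat -> nat) a := \sum_(c <- verts w | adj w a c) f c.
Definition mdeg w a := nbr_sum w (fun=> 1) a.

Definition model_lip w (f : nat * nat -> nat) : Prop :=
  {in verts w &, forall c d : nat * nat, arc w c d -> f d <= (f c).+1 /\ f c <= (f d).+1}.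

Section Transfer.
Variables (V : finType) (e : rel V) (w : seq branch) (G : nat * nat -> V).
Hypothesis pres : presents e w G.

Lemma presents_big (T : Type) (idx : T) (op : Monoid.com_law idx) (P : pred V) (F : V -> T) :
  \big[op/idx]_(x | P x) F x = \big[op/idx]_(c <- verts w | P (G c)) F (G c).
Proof.
have [G_inj G_surj _] := pres.
rewrite -[RHS](big_map G); apply: perm_big; apply: uniq_perm.
- exact: index_enum_uniq.
- by rewrite map_inj_in_uniq // verts_uniq.
- by move=> x; rewrite mem_index_enum G_surj.
Qed.

Lemma presents_card : #|V| = size (verts w).
Proof. by rewrite -sum1_card presents_big sum1_size. Qed.

Lemma presents_nbr a (T : Type) (idx : T) (op : Monoid.com_law idx) (F : V -> T) :
  a \in verts w ->
  \big[op/idx]_(x | e (G a) x) F x = \big[op/idx]_(c <- verts w | adj w a c) F (G c).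
Proof.
have [_ _ Ge] := pres; move=> va; rewrite presents_big.
rewrite big_seq_cond [RHS]big_seq_cond; apply: eq_bigl => c.
by case vc: (c \in verts w); rewrite //= Ge.
Qed.

Lemma presents_deg a : a \in verts w -> deg e (G a) = mdeg w a.
Proof.
move=> va; rewrite /deg -sum1_card.
transitivity (\sum_(x | e (G a) x) 1)%N; first by apply: eq_bigl => x; rewrite inE.
exact: presents_nbr.
Qed.

(** This is [curv_pos] over the natural numbers: the terms subtracted in the two sums differ by the
    product of the degrees because [f b = (f a).+1]. *)
Lemma model_curv f a b : curv_pos e -> model_lip w f -> a \in verts w -> b \in verts w ->
  adj w a b -> f b = (f a).+1 ->
  mdeg w a * nbr_sum w f b < mdeg w b * nbr_sum w f a + mdeg w a * mdeg w b.
Proof.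
have [G_inj G_surj Ge] := pres; move=> pos Lf va vb ab fab.
(* [f] is carried over to [V] by the inverse of [G], found by searching [verts w]. *)
pose F (x : V) : int := ((f (nth (hub w) (verts w) (find (fun c => G c == x) (verts w))))%:Z)%R.
have FG c : c \in verts w -> F (G c) = f c.
  move=> vc; have found : has (fun d => G d == G c) (verts w) by apply/hasP; exists c.
  rewrite /F; have /eqP/G_inj -> // := nth_find (hub w) found.
  by rewrite mem_nth // -has_find.
have LF : lip1 e F.
  move=> x y; have /mapP[c vc ->] := G_surj x; have /mapP[d vd ->] := G_surj y.
  rewrite Ge // !FG // => /orP[/Lf|/Lf] => [/(_ vc vd)|/(_ vd vc)]; lia.
have eab : e (G a) (G b) by rewrite Ge.
have FGab : (F (G b) = F (G a) + 1)%R by rewrite !FG // fab; lia.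
have := pos _ _ F eab LF FGab; rewrite !FG //.
rewrite !presents_deg //.
have sumE c : c \in verts w -> (\sum_(x | e (G c) x) (F x - (f c)%:Z) =
    (nbr_sum w f c)%:Z - (mdeg w c)%:Z * (f c)%:Z)%R.
  move=> vc; rewrite presents_nbr // sumrB; congr (_ - _)%R.
    rewrite /nbr_sum -!natz natr_sum big_seq_cond [RHS]big_seq_cond.
    by apply: eq_bigr => d /andP[vd _]; rewrite FG // natz.
  rewrite /mdeg /nbr_sum -!natz natr_sum mulr_suml; apply: eq_bigr => d _.
  by rewrite mul1r.
rewrite !sumE // fab; move: (mdeg w a) (mdeg w b) (nbr_sum _ _ _) (nbr_sum _ _ _) (f a).
move=> da db Sa Sb fa; nia.
Qed.
End Transfer.

(** * Bounds on the degree of the hub *)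

Lemma hub_in w : hub w \in verts w. Proof. exact: mem_head. Qed.

Lemma spoke_in w i : i < size w -> (i, 0) \in verts w.
Proof. by move=> lti; rewrite mem_verts /= lti bsize_gt0 orbT. Qed.

Lemma adj_hub w i j : i < size w -> adj w (hub w) (i, j) = (j == 0).
Proof.
move=> lti; rewrite /adj /arc /tree_arc /leaf_arc /= !eqxx ltnn lti /= xpair_eqE.
by rewrite (ltn_eqF lti) /= (gtn_eqF (ltn_pmod _ _)) ?andbF ?orbF //; apply: leq_ltn_trans lti.
Qed.

Lemma nbr_sum_hub w f : nbr_sum w f (hub w) = \sum_(0 <= i < size w) f (i, 0).
Proof.
rewrite /nbr_sum /verts big_cons.
have -> : adj w (hub w) (hub w) = false.
  by rewrite /adj /arc /tree_arc /leaf_arc /= ltnn andbF.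
rewrite big_mkcond big_allpairs_dep /= /index_iota subn0 big_seq [RHS]big_seq.
apply: eq_bigr => i; rewrite mem_iota => /= lti.
have [n ->] : exists n, bsize (nth Leaf w i) = n.+1 by case: (nth _ _ _) => [||b]; eexists.
rewrite /= big_cons adj_hub // big_seq big1 ?addn0 // => j.
by rewrite mem_iota adj_hub // => /andP[]; case: j.
Qed.

Lemma mdeg_hub w : mdeg w (hub w) = size w.
Proof. by rewrite /mdeg nbr_sum_hub sum_nat_const_nat muln1 subn0. Qed.

Lemma nbr_sum_seq w f a (l : seq (nat * nat)) : uniq l ->
  (forall c, (c \in verts w) && adj w a c = (c \in l)) -> nbr_sum w f a = \sum_(c <- l) f c.
Proof.
move=> ul memE; rewrite /nbr_sum -big_filter; apply: perm_big; apply: uniq_perm => //.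
  by rewrite filter_uniq // verts_uniq.
by move=> c; rewrite mem_filter andbC memE.
Qed.

Lemma spokeP b : spoke b -> b = Leaf \/ b = Stem Leaf.
Proof. by case: b => [||[]] //; auto. Qed.

Lemma modS i D : i < D -> (i.+1 < D /\ i.+1 %% D = i.+1) \/ (i.+1 = D /\ i.+1 %% D = 0).
Proof.
move=> lti; have [lt|ge] := ltnP i.+1 D; [left|right]; first by rewrite modn_small.
have -> : D = i.+1 by lia.
by rewrite modnn.
Qed.

(** The edge from the subdividing vertex [(0, 0)] to the hub is tested. With D the degree of the hub
    and S the sum of [f] over its neighbours, positive curvature gives S < 2D, while S is at least
    3D - 8. *)
Lemma stem_spokes_le7 (V : finType) (e : rel V) w G : curv_pos e -> presents e w G ->
  all spoke w -> nth Leaf w 0 = Stem Leaf -> 3 <= size w -> size w <= 7.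
Proof.
move=> pos pres sp w0 gt2; rewrite leqNgt; apply/negP => gt7.
have spw i : nth Leaf w i = Leaf \/ nth Leaf w i = Stem Leaf.
  have [lti|gei] := ltnP i (size w); last by left; rewrite nth_default.
  by apply: spokeP; apply: (all_nthP Leaf sp).
(* A 1-Lipschitz lower bound for the distance to the leaf of branch 0, clipped at 3. *)
pose f (c : nat * nat) := if c.1 == size w then 2 else
  let k := minn c.1 (size w - c.1) in
  if c.2 == blast (nth Leaf w c.1) then minn k 3
  else (0 < k) + (2 < k) + 1.
have Lf : model_lip w f.
  move=> [i j] [k l]; rewrite !mem_verts => vc vd /orP[/orP[]|].
  - move=> /= /andP[/andP[/eqP[-> ->] ltk] /eqP->].
    rewrite /f /= eqxx (ltn_eqF ltk); case: (spw k) => ek; rewrite ek /=.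
      have: k != 0 by apply/eqP => k0; rewrite k0 w0 in ek.
      lia.
    lia.
  - move=> /and3P[/= lti /eqP eik]; rewrite -eik; rewrite /f /= (ltn_eqF lti).
    case: (spw i) => -> //=; case: j vc => // vc; case: l vd => [|[|l]] vd //= _.
    lia.
  - move=> /andP[/= lti]; have nochord : bchord (nth Leaf w i) j l = false.
      by case: (spw i) => ->; case: j {vc} => [|[|?]]; case: (l) => [|[|?]].
    rewrite nochord andbF /= => /and3P[/eqP ek /eqP-> /eqP->].
    have ltk : k < size w by rewrite ek ltn_mod; apply: leq_ltn_trans lti.
    have E m : bfirst (nth Leaf w m) = blast (nth Leaf w m) by case: (spw m) => ->.
    rewrite /f /= E !eqxx (ltn_eqF lti) (ltn_eqF ltk).
    case: (modS lti) => -[lt em]; rewrite em in ek; lia.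
have v0 : (0, 0) \in verts w by apply: spoke_in; lia.
have h0 : adj w (0, 0) (hub w) by rewrite adj_sym adj_hub //; lia.
have fh : f (hub w) = 2 by rewrite /f eqxx.
have f00 : f (0, 0) = 1 by rewrite /f /= (ltn_eqF (ltnW (ltnW gt2))) w0 min0n.
have f01 : f (0, 1) = 0 by rewrite /f /= (ltn_eqF (ltnW (ltnW gt2))) w0 !min0n.
have := model_curv pres pos Lf v0 (hub_in w) h0.
rewrite fh f00 mdeg_hub => /(_ erefl).
have memE c : (c \in verts w) && adj w (0, 0) c = (c \in [:: hub w; (0, 1)]).
  rewrite mem_verts !inE; have [->|nc] := eqVneq c (hub w); first by rewrite h0.
  have w1 : 0 < size w by lia.
  case: c nc => i j nc /=; apply/andP/eqP => [[/andP[lti ltj]]|[-> ->]]; last first.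
    by rewrite /adj /arc /tree_arc /= w0 w1 orbT.
  rewrite /adj /arc /tree_arc /leaf_arc /= (negPf nc) /hub xpair_eqE /= (ltn_eqF w1) w1 lti /=.
  have [ei|ni] := eqVneq 0 i.
    rewrite -ei w0 /= in ltj *.
    by case: j {ltj nc} => [|[|j]] //=; rewrite ?andbF.
  by rewrite w0 /= !andbF /=.
have ul : uniq [:: hub w; (0, 1)] by rewrite /= inE xpair_eqE andbF.
rewrite /mdeg !(nbr_sum_seq _ ul memE) !big_cons !big_nil nbr_sum_hub.
rewrite fh f01.
suff : 3 * size w <= \sum_(0 <= i < size w) f (i, 0) + 8 by move: (\sum_(_ <= i < _) _) => S; lia.
(* The first three and the last two indices are those at cyclic distance less than 3 from 0; [f] is
   at least 3 on the other spokes. *)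
have [n Dn] : exists n, size w = 3 + (n + 2) by exists (size w - 5); lia.
have mid : 3 * n <= \sum_(3 <= i < 3 + n) f (i, 0).
  rewrite mulnC -{1}(addKn 3 n) -sum_nat_const_nat big_nat_cond [leqRHS]big_nat_cond.
  apply: leq_sum => i /andP[/andP[ge3 ltn] _].
  rewrite /f /= ltn_eqF; last by lia.
  by case: (spw i) => -> /=; lia.
rewrite [in X in _ <= X + _]Dn (_ : 3 + (n + 2) = (3 + n).+2); last by lia.
rewrite big_nat_recr // big_nat_recr // 3?big_ltn //=.
have : 1 <= f (0, 0) by rewrite f00.
have : 1 <= f (1, 0) by rewrite /f ltn_eqF /=; [case: (spw 1) => -> /=|]; lia.
have : 2 <= f (2, 0) by rewrite /f ltn_eqF /=; [case: (spw 2) => -> /=|]; lia.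
have : 2 <= f (3 + n, 0) by rewrite /f ltn_eqF /=; [case: (spw (3 + n)) => -> /=|]; lia.
have : 1 <= f ((3 + n).+1, 0) by rewrite /f ltn_eqF /=; [case: (spw (3 + n).+1) => -> /=|]; lia.
lia.
Qed.

(** The edge from the middle one of the three leaves to the hub is tested. Positive curvature gives
    3S < 4D, with S and D as in [stem_spokes_le7], while S is at least 2D - 8. *)
Lemma wheel_le11 (V : finType) (e : rel V) w G : curv_pos e -> presents e w G ->
  (forall i, nth Leaf w i = Leaf) -> 3 <= size w -> size w <= 11.
Proof.
move=> pos pres wL gt2; rewrite leqNgt; apply/negP => gt11.
(* The distance to three consecutive leaves, clipped at 2. *)
pose f (c : nat * nat) := if c.1 == size w then 1 else (minn (minn c.1 (size w - c.1)) 3).-1.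
have Lf : model_lip w f.
  move=> [i j] [k l] _ _ /orP[/orP[]|].
  - move=> /= /andP[/andP[/eqP[-> ->] ltk] _].
    by rewrite /f /= eqxx (ltn_eqF ltk); lia.
  - by rewrite wL !andbF.
  - move=> /andP[/= lti]; rewrite wL /= andbF /= => /andP[/eqP ek _].
    have ltk : k < size w by rewrite ek ltn_mod; apply: leq_ltn_trans lti.
    rewrite /f /= (ltn_eqF lti) (ltn_eqF ltk).
    case: (modS lti) => -[lt em]; rewrite em in ek; lia.
have w1 : 0 < size w by lia.
have v0 : (0, 0) \in verts w by apply: spoke_in.
have h0 : adj w (0, 0) (hub w) by rewrite adj_sym adj_hub.
have fh : f (hub w) = 1 by rewrite /f eqxx.
have f00 : f (0, 0) = 0 by rewrite /f /= (ltn_eqF w1) !min0n.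
have f10 : f (1, 0) = 0 by rewrite /f ltn_eqF /=; lia.
have fl0 : f ((size w).-1, 0) = 0 by rewrite /f ltn_eqF /=; lia.
have := model_curv pres pos Lf v0 (hub_in w) h0.
rewrite fh f00 mdeg_hub => /(_ erefl).
have memE c : (c \in verts w) && adj w (0, 0) c = (c \in [:: hub w; (1, 0); ((size w).-1, 0)]).
  rewrite mem_verts !inE; have [->|nc] := eqVneq c (hub w); first by rewrite h0.
  case: c nc => i j nc /=; rewrite wL /= ltnS leqn0.
  rewrite /adj /arc /tree_arc /leaf_arc /= (negPf nc) !wL /= !andbF !orbF !xpair_eqE /=.
  rewrite (ltn_eqF w1) w1 /= modn_small; last by lia.
  have [lti|gei] := ltnP i (size w); last by case: eqP => //=; lia.
  rewrite !andbT /=; case: (modS lti) => -[lt ->]; case: (j == 0); lia.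
have ul : uniq [:: hub w; (1, 0); ((size w).-1, 0)].
  by rewrite /= !inE !xpair_eqE /=; lia.
rewrite /mdeg !(nbr_sum_seq _ ul memE) !big_cons !big_nil nbr_sum_hub fh f10 fl0.
have [n Dn] : exists n, size w = 3 + (n + 2) by exists (size w - 5); lia.
have mid : 2 * n <= \sum_(3 <= i < 3 + n) f (i, 0).
  rewrite mulnC -{1}(addKn 3 n) -sum_nat_const_nat big_nat_cond [leqRHS]big_nat_cond.
  apply: leq_sum => i /andP[/andP[ge3 ltn] _].
  by rewrite /f /= ltn_eqF; lia.
have f20 : f (2, 0) = 1 by rewrite /f ltn_eqF /=; lia.
have fn0 : f (3 + n, 0) = 1 by rewrite /f ltn_eqF /=; lia.
have : 2 * n + 2 <= \sum_(0 <= i < size w) f (i, 0).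
  rewrite [in X in _ <= X]Dn (_ : 3 + (n + 2) = (3 + n).+2); last by lia.
  by rewrite big_nat_recr // big_nat_recr // 3?big_ltn //= f20 fn0; lia.
move: (\sum_(_ <= _ < _) _) => S; lia.
Qed.

(** * Finite check *)

(* Call-by-value evaluation makes [has] and [&&] strict: [find] and [if] stop early. *)
Definition lazy_has (T : Type) (p : pred T) s := find p s < size s.

Lemma lazy_hasE (T : Type) (p : pred T) s : lazy_has p s = has p s.
Proof. by rewrite has_find. Qed.

(** The balls of radius 0 to k - 1 about [A]; the number of those that miss a vertex is its distance
    to [A], clipped at k. *)
Fixpoint dist_levels (vs : seq (nat * nat)) nb k (A : seq (nat * nat)) : seq (seq (nat * nat)) :=
  if k is k'.+1 then
    A :: dist_levels vs nb k' [seq c <- vs | (c \in A) || has (mem A) (nb c)]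
  else [::].

(** The inequality is the negation of the one in [model_curv]. The Lipschitz condition is checked by
    computation as well, so soundness does not rely on [f] being a distance. *)
Definition violates (vs : seq (nat * nat)) nb (f : nat * nat -> nat) : bool :=
  let S a := sumn [seq f c | c <- nb a] in
  if lazy_has (fun a => lazy_has (fun b =>
       if f b == (f a).+1 then
         size (nb b) * S a + size (nb a) * size (nb b) <= size (nb a) * S b
       else false) (nb a)) vs
  then all (fun c => all (fun d => f d <= (f c).+1) (nb c)) vs else false.

(* The test functions are the distances to one or two vertices, clipped at 4. *)
Definition excluded w : bool :=
  let vs := verts w in
  let table := [seq [seq b <- vs | adj w a b] | a <- vs] in
  let nb a := nth [::] table (index a vs) in
  lazy_has (fun A =>
    let L := dist_levels vs nb 4 A in
    let F := [seq count (fun B => c \notin B) L | c <- vs] in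
    violates vs nb (fun c => nth 0 F (index c vs)))
  ([seq [:: a] | a <- vs] ++ [seq [:: a; b] | a <- vs, b <- vs]).

Lemma excluded_sound (V : finType) (e : rel V) w G : curv_pos e -> presents e w G ->
  ~~ excluded w.
Proof.
move=> pos pres; apply/negP; rewrite /excluded lazy_hasE => /hasP[A _].
set nb := fun a => nth _ _ _; set f := fun c => nth 0 _ _; rewrite /violates.
have nbE a : a \in verts w -> nb a = [seq b <- verts w | adj w a b].
  by move=> va; rewrite /nb (nth_map (hub w)) ?index_mem // nth_index.
have SE a : a \in verts w -> sumn [seq f c | c <- nb a] = nbr_sum w f a.
  by move=> va; rewrite nbE // /nbr_sum sumnE big_map big_filter.
have dE a : a \in verts w -> size (nb a) = mdeg w a.
  by move=> va; rewrite nbE // -sum1_size big_filter.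
case: ifP => // + /allP lip; rewrite lazy_hasE => /hasP[a va]; rewrite lazy_hasE => /hasP[b].
rewrite [nb a]nbE // mem_filter => /andP[ab vb]; case: eqP => // fab.
rewrite -[[seq _ <- _ | _]]nbE // !SE // !dE // => le.
have L c d : c \in verts w -> d \in verts w -> adj w c d -> f d <= (f c).+1.
  by move=> vc vd cd; have := lip c vc; rewrite /= => /allP lipc; apply: lipc;
     rewrite nbE // mem_filter cd.
have Lf : model_lip w f.
  by move=> c d vc vd cd; split; apply: L; rewrite // /adj cd ?orbT.
by have := model_curv pres pos Lf va vb ab fab; rewrite ltnNge le.
Qed.

Definition lookup w (F : seq nat) (c : nat * nat) : nat := nth 0 F (index c (verts w)).

(* [blocks] lists, spoke by spoke, the vertices of the target; vertex 0 is the hub. *)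
Definition matches w n (r : nat -> nat -> bool) (blocks : seq (seq nat)) : bool :=
  if n == size (verts w) then
  has (fun k => let s := 0 :: flatten (rot k blocks) in
    perm_eq s (iota 0 n) &&
      all (fun a => all (fun b => adj w a b == sym_rel r (lookup w s a) (lookup w s b))
        (verts w)) (verts w)) (iota 0 (size blocks))
  else false.

(** Reading [s] along [verts w] gives the isomorphism, bijective as [s] is a permutation of the
    vertices. The rotations of [blocks] account for the choice of the first branch. *)
Lemma matches_sound (V : finType) (e : rel V) w G n r blocks : presents e w G ->
  matches w n r blocks -> isomorphic e (ord_rel n r).
Proof.
move=> pres; rewrite /matches; case: eqP => // n_eq /hasP[k _].
set s := 0 :: _ => /andP[ps /allP eqr].
have [G_inj G_surj Ge] := pres.
have us : uniq s by rewrite (perm_uniq ps) iota_uniq.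
have ns : size s = n by rewrite (perm_size ps) size_iota.
have ss : size s = size (verts w) by rewrite ns.
pose code x := nth (hub w) (verts w) (find (fun c => G c == x) (verts w)).
have codeP x : code x \in verts w /\ G (code x) = x.
  have found : has (fun c => G c == x) (verts w).
    by have /mapP[c vc ->] := G_surj x; apply/hasP; exists c.
  by rewrite /code mem_nth -?has_find //; split=> //; apply/eqP/(nth_find _ found).
have lt_s x : lookup w s (code x) < n.
  have : lookup w s (code x) \in s by rewrite mem_nth // ss index_mem; case: (codeP x).
  by rewrite (perm_mem ps) mem_iota.
exists (fun x => Ordinal (lt_s x)); split.
  apply: inj_card_bij; last by rewrite card_ord (presents_card pres) -ss ns.
  move=> x y /(congr1 val) /= /eqP.
  have [vx xE] := codeP x; have [vy yE] := codeP y.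
  rewrite nth_uniq ?ss ?index_mem // => /eqP/(congr1 (nth (hub w) (verts w))).
  by rewrite !nth_index // => eqc; rewrite -xE -yE eqc.
move=> x y; have [vx xE] := codeP x; have [vy yE] := codeP y.
have /eqP eqxy := allP (eqr _ vx) _ vy.
by rewrite -[in LHS]xE -[in LHS]yE Ge.
Qed.

(** [matches] computes with numbers, so the relation inside [ord_rel] is extracted. *)
Ltac nat_rel H := let x := eval unfold H in H in
  match x with ord_rel _ ?r => exact r end.

Definition wheel_blocks n := [seq [:: i] | i <- iota 1 n.-1].
(** The block of a subdivided spoke begins with the subdividing vertex, the root of [Stem Leaf]. *)
Definition W1_blocks n := [:: n.-1; 1] :: [seq [:: i] | i <- iota 2 (n - 3)].
Definition W2_blocks n :=
  [:: n - 2; 1] :: [seq if i == uphalf (n - 2) then [:: n.-1; i] else [:: i] | i <- iota 2 (n - 4)].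

(** [iota] takes a start and a length: the three ranges are 4 to 12, 5 to 9 and 6 to 10. *)
Definition is_wheel w := has (fun n => matches w n (wheel_r n) (wheel_blocks n)) (iota 4 9).
Definition is_W1 w := has (fun n => matches w n (W1_r n) (W1_blocks n)) (iota 5 5).
Definition is_W2 w := has (fun n => matches w n (W2_r n) (W2_blocks n)) (iota 6 5).
Definition is_H1 w := matches w 7 ltac:(nat_rel H1) [:: [:: 1; 4]; [:: 2; 5]; [:: 3; 6]].
Definition is_H2 w := matches w 6 ltac:(nat_rel H2) [:: [:: 1; 2; 3]; [:: 4]; [:: 5]].
Definition is_H3 w := matches w 6 ltac:(nat_rel H3) [:: [:: 3; 4; 5]; [:: 1]; [:: 2]].
(* The word of H4 differs from its mirror image, so both have to be recognised. *)
Definition is_H4 w := matches w 7 ltac:(nat_rel H4) [:: [:: 4; 5; 6]; [:: 1; 2]; [:: 3]] ||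
  matches w 7 ltac:(nat_rel H4) [:: [:: 4; 6; 5]; [:: 3]; [:: 1; 2]].
Definition is_H5 w := matches w 7 ltac:(nat_rel H5) [:: [:: 1; 2; 5; 6]; [:: 3]; [:: 4]].
Definition is_H6 w := matches w 7 ltac:(nat_rel H6) [:: [:: 1; 3]; [:: 2; 4]; [:: 5]; [:: 6]].
Definition is_H7 w := matches w 7 ltac:(nat_rel H7) [:: [:: 1; 2; 3]; [:: 4]; [:: 5]; [:: 6]].
Definition is_H8 w := matches w 8 ltac:(nat_rel H8) [:: [:: 1; 2; 3]; [:: 4]; [:: 7; 5]; [:: 6]].

Definition listed w : bool := (size (verts w) <= 12) &&
  [|| is_wheel w, is_W1 w, is_W2 w, is_H1 w, is_H2 w, is_H3 w, is_H4 w, is_H5 w, is_H6 w,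
      is_H7 w | is_H8 w].

Definition settled w : bool := if excluded w then true else listed w.

Fixpoint words (l : seq branch) n : seq (seq branch) :=
  if n is n'.+1 then flatten [seq [seq b :: s | s <- words l n'] | b <- l] else [:: [::]].

Lemma all_flatten (T : Type) (P : pred T) ss : all P (flatten ss) = all (all P) ss.
Proof. by elim: ss => //= s ss IHss; rewrite all_cat IHss. Qed.

(** The hypothesis on [Q] expresses that [l] contains every letter satisfying [ok], without an
    equality test on [branch]. *)
Lemma all_words (l : seq branch) (ok : pred branch) (P : pred (seq branch)) s :
  (forall Q b, all Q l -> ok b -> Q b) -> all P (words l (size s)) -> all ok s -> P s.
Proof.
move=> okl; elim: s P => [|b s IHs] P /=; first by rewrite andbT.
rewrite all_flatten all_map => Pl /andP[okb oks].
have := okl _ b Pl okb; rewrite /= all_map => Pb.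
exact: (IHs (fun s => P (b :: s))).
Qed.

(** Here [n] does not count the first letter: the lengths are 3 to 7, and 3 to 5 for words with a
    fork, as the bounds on the hub degree allow. *)
Definition stem_words_settled := all (fun n => all (fun s => settled (Stem Leaf :: s))
  (words [:: Leaf; Stem Leaf] n)) (iota 2 5).
Definition fork_words_settled := all (fun n => all (fun s => settled (Fork :: s))
  (words [:: Leaf; Stem Leaf; Fork] n)) (iota 2 3).
Definition wheels_settled := all (fun n => settled (nseq n Leaf)) (iota 3 9).

Lemma stem_words_settledT : stem_words_settled. Proof. by vm_compute. Qed.
Lemma fork_words_settledT : fork_words_settled. Proof. by vm_compute. Qed.
Lemma wheels_settledT : wheels_settled. Proof. by vm_compute. Qed.
(** The two words that come from [hub_deg2]. *)
Lemma long_words_settled :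
  settled [:: Stem (Stem Leaf); Leaf; Leaf] && settled [:: Stem Fork; Leaf; Leaf].
Proof. by vm_compute. Qed.

(** * Assembly of the classification *)

Section Conclusion.
Variables (V : finType) (e : rel V).

Definition conclusion : Prop :=
  (#|V| <= 12)%N /\
  ((exists n : nat, (4 <= n <= 12)%N /\ isomorphic e (W n)) \/
   (exists n : nat, (5 <= n <= 9)%N /\ isomorphic e (W1 n)) \/
   (exists n : nat, (6 <= n <= 10)%N /\ isomorphic e (W2 n)) \/
   isomorphic e H1 \/ isomorphic e H2 \/ isomorphic e H3 \/ isomorphic e H4 \/
   isomorphic e H5 \/ isomorphic e H6 \/ isomorphic e H7 \/ isomorphic e H8).

Lemma settled_sound w G : curv_pos e -> presents e w G -> settled w -> conclusion.
Proof.
move=> pos pres; rewrite /settled (negPf (excluded_sound pos pres)) => /andP[card_le L].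
split; first by rewrite (presents_card pres).
have M n r blocks : matches w n r blocks -> isomorphic e (ord_rel n r) := matches_sound pres.
case/orP: L => [/hasP[n + /M m]|L].
  by rewrite mem_iota => n_in; left; exists n; split.
case/orP: L => [/hasP[n + /M m]|L].
  by rewrite mem_iota => n_in; right; left; exists n; split.
case/orP: L => [/hasP[n + /M m]|L].
  by rewrite mem_iota => n_in; right; right; left; exists n; split.
do 3! right.
case/orP: L => [/M m|L]; [by left|right].
case/orP: L => [/M m|L]; [by left|right].
case/orP: L => [/M m|L]; [by left|right].
case/orP: L => [/orP[] /M m|L]; [by left|by left|right].
case/orP: L => [/M m|L]; [by left|right].
case/orP: L => [/M m|L]; [by left|right].
by case/orP: L => /M m; [left|right].
Qed.

Lemma simple_word_settled w G : curv_pos e -> presents e w G -> 3 <= size w ->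
  simple_word w -> settled w.
Proof.
move=> pos pres gt2 [[s [ew sp le5]]|[s [ew sp]]|ew].
- rewrite ew /= in gt2 le5 *; have /allP H := fork_words_settledT.
  apply: (all_words (l := [:: Leaf; Stem Leaf; Fork]) (P := fun s => settled (Fork :: s)) _ _ sp).
    by move=> Q [||[]] //= /and3P[? ? /andP[]].
  by apply: H; rewrite mem_iota; lia.
- have le7 : size w <= 7.
    by apply: (stem_spokes_le7 pos pres) => //; rewrite ew.
  rewrite ew /= in gt2 le7 *; have /allP H := stem_words_settledT.
  apply: (all_words (l := [:: Leaf; Stem Leaf]) (P := fun s => settled (Stem Leaf :: s)) _ _ sp).
    by move=> Q [||[]] //= /and3P[].
  by apply: H; rewrite mem_iota; lia.
- have le11 : size w <= 11.
    by apply: (wheel_le11 pos pres) => // i; rewrite ew nth_nseq if_same.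
  by have /allP H := wheels_settledT; rewrite ew; apply: H; rewrite mem_iota; lia.
Qed.
End Conclusion.

Lemma gen_halin_conclusion (V : finType) (e : rel V) : gen_halin e -> curv_pos e -> conclusion e.
Proof.
move=> [t [rho [tree_t [branching [rot eE]]]]] pos.
have [h [q [w [H word]]]] := classification tree_t rot branching eE pos.
have pres := place_presents tree_t rot branching eE H.
apply: (settled_sound pos pres); case: word => [[b [[] -> ->]]|sw].
- by case/andP: long_words_settled.
- by case/andP: long_words_settled.
- by apply: simple_word_settled pos pres _ sw; case: H => _ + ->.
Qed.

Local Open Scope ring_scope.

Theorem theorem1p3 (R : realType) (V : finType) (e : rel V) :
  simple_graph e -> connected_graph e ->
  gen_halin e ->
  (forall u v : V, e u v -> exists k : R, 0 < k /\ LLY_curvature_is e u v k) ->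
  (#|V| <= 12)%N /\
  ((exists n : nat, (4 <= n <= 12)%N /\ isomorphic e (W n)) \/
   (exists n : nat, (5 <= n <= 9)%N /\ isomorphic e (W1 n)) \/
   (exists n : nat, (6 <= n <= 10)%N /\ isomorphic e (W2 n)) \/
   isomorphic e H1 \/ isomorphic e H2 \/ isomorphic e H3 \/ isomorphic e H4 \/
   isomorphic e H5 \/ isomorphic e H6 \/ isomorphic e H7 \/ isomorphic e H8).
Proof.
move=> simple_e conn_e halin_e pos; apply: (gen_halin_conclusion halin_e).
exact: positive_LLY_curv_pos pos.
Qed.
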